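(* Let $\pi=x\,\partial_x\wedge\partial_y$ on $\mathbb{R}^3$. The Poisson cohomology groups of $(\mathbb{R}^3,\pi)$ are uniquely described as follows: - the Casimir functions, i.e. $H^0(\mathbb{R}^3,\pi)$, are the functions $f(z)$ with $f\in C^\infty(\mathbb{R})$; - $H^1(\mathbb{R}^3,\pi)$ is a free module over $H^0(\mathbb{R}^3,\pi)$ with two generators, the classes of $\partial_y$ and $\partial_z$; - $H^2(\mathbb{R}^3,\pi)$ is a free module over $H^0(\mathbb{R}^3,\pi)$ with one generator, the class of $\partial_y\wedge\partial_z$; - $H^3(\mathbb{R}^3,\pi)=0$. The wedge product and the Schouten–Nijenhuis bracket preserve these representatives (the $H^0$-linear combinations of the listed generators), which yields the algebraic structure on $H^\bullet(\mathbb{R}^3,\pi)$.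
   Context: For a Poisson structure $\pi$ on a manifold $M$ (a bivector field with $[\pi,\pi]=0$, where $[\cdot,\cdot]$ is the Schouten–Nijenhuis bracket), the Poisson cohomology $H^\bullet(M,\pi)$ is the cohomology of the complex $(\mathfrak{X}^\bullet(M),d_\pi:=[\pi,\cdot])$ of smooth multivector fields. The wedge product and Schouten–Nijenhuis bracket descend to $H^\bullet(M,\pi)$. Coordinates on $\mathbb{R}^3$ are $(x,y,z)$; $\pi$ is the linear Poisson structure associated with $\mathfrak{aff}(1,\mathbb{R})\times\mathbb{R}$. *)

(* Defs.v *)
From HB Require Import structures.
From mathcomp Require Import all_boot all_order all_algebra.
From mathcomp Require Import all_classical all_reals all_analysis.

Set Implicit Arguments.
Unset Strict Implicit.
Unset Printing Implicit Defensive.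

Import Order.TTheory GRing.Theory Num.Theory.
Import numFieldNormedType.Exports.
Local Open Scope ring_scope.

Definition is_basis (A : pzRingType) (M : lmodType A) (m : nat)
    (b : m.-tuple M) : Prop :=
  forall v : M, exists! c : {ffun 'I_m -> A}, v = \sum_i c i *: tnth b i.

Section QuotientModule.
Variables (A : pzRingType) (M : lmodType A) (N : submodClosed M).

(* submodClosed does not inherit from zmodClosed, which quot requires. *)
Definition submod_sub : {pred M} := fun v => v \in N.
HB.instance Definition _ :=
  GRing.isZmodClosed.Build M submod_sub (GRing.submod_closedB (submodClosedP N)).

Definition quotmod := Quotient.quot submod_sub.
HB.instance Definition _ := GRing.Zmodule.on quotmod.

Definition proj_quotmod (v : M) : quotmod := (\pi_quotmod v)%qT.

Lemma proj_quotmodE u v : proj_quotmod u = proj_quotmod v <-> u - v \in N.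
Proof.
have uvE := Quotient.idealrBE submod_sub u v.
by split=> [/eqP|uv]; [|apply/eqP]; rewrite -uvE.
Qed.

Lemma proj_quotmodD : {morph proj_quotmod : u v / u + v}.
Proof. exact: (@Quotient.pi_add _ submod_sub). Qed.

Definition scale_quotmod (a : A) (u : quotmod) : quotmod :=
  proj_quotmod (a *: repr u).

Lemma scale_proj_quotmod a v :
  scale_quotmod a (proj_quotmod v) = proj_quotmod (a *: v).
Proof.
apply/proj_quotmodE; rewrite -scalerBr rpredZ//; apply/proj_quotmodE.
by rewrite /proj_quotmod reprK.
Qed.

Lemma proj_quotmod_surj u : {v | u = proj_quotmod v}.
Proof. by exists (repr u); rewrite /proj_quotmod reprK. Qed.

Let scaleA a b u :
  scale_quotmod a (scale_quotmod b u) = scale_quotmod (a * b) u.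
Proof.
by have [v ->] := proj_quotmod_surj u; rewrite !scale_proj_quotmod scalerA.
Qed.
Let scale1 : left_id 1 scale_quotmod.
Proof.
by move=> u; have [v ->] := proj_quotmod_surj u;
  rewrite scale_proj_quotmod scale1r.
Qed.
Let scaleDr : right_distributive scale_quotmod +%R.
Proof.
move=> a u v; have [u' ->] := proj_quotmod_surj u.
have [v' ->] := proj_quotmod_surj v.
by rewrite -proj_quotmodD !scale_proj_quotmod scalerDr proj_quotmodD.
Qed.
Let scaleDl u : {morph scale_quotmod^~ u : a b / a + b}.
Proof.
move=> a b; have [v ->] := proj_quotmod_surj u.
by rewrite !scale_proj_quotmod scalerDl proj_quotmodD.
Qed.

HB.instance Definition _ :=
  GRing.Zmodule_isLmodule.Build A quotmod scaleA scale1 scaleDr scaleDl.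

End QuotientModule.

Definition smooth1 (R : realType) (g : R -> R) : Prop :=
  forall (k : nat) (t : R), derivable (derive1n k g) t 1.

Section SmoothFunctions.
Variables (R : realType) (n : nat).
Local Notation V := 'rV[R]_n.
Implicit Types (f g : V -> R).

Definition evec (i : 'I_n) : V := delta_mx 0 i.

Fixpoint Ck (k : nat) f : Prop :=
  continuous f /\
  (if k is k'.+1 then
     forall i, (forall p, derivable f p (evec i)) /\ Ck k' ('D_(evec i) f)
   else True).

Definition smooth f : Prop := forall k, Ck k f.

Lemma Ck_cont k f : Ck k f -> continuous f.
Proof. by case: k => [|k] []. Qed.

Lemma CkW k f : Ck k.+1 f -> Ck k f.
Proof.
elim: k f => [|k IH] f; first by move=> [].
by move=> [cf Df]; split=> // i; have [df /IH] := Df i.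
Qed.

Lemma Ck_cst k (c : R) : Ck k (cst c).
Proof.
elim: k c => [|k IH] c; first by split=> //; exact: cst_continuous.
split=> [|i]; first exact: cst_continuous.
split=> [p|]; first exact: derivable_cst.
suff -> : 'D_(evec i) (cst c : V -> R) = cst 0 by exact: IH.
by apply/funext => p; rewrite derive_cst.
Qed.

Lemma CkD k f g : Ck k f -> Ck k g -> Ck k (f + g).
Proof.
elim: k f g => [|k IH] f g.
  by move=> [cf _] [cg _]; split=> // p; apply: continuousD; [exact: cf|exact: cg].
move=> [cf Df] [cg Dg]; split=> [p|i].
  by apply: continuousD; [exact: cf|exact: cg].
have [[df Cf] [dg Cg]] := (Df i, Dg i).
split=> [p|]; first exact: derivableD.
suff -> : 'D_(evec i) (f + g) = 'D_(evec i) f + 'D_(evec i) g by exact: IH.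
by apply/funext => p; rewrite deriveD.
Qed.

Lemma CkM k f g : Ck k f -> Ck k g -> Ck k (f * g).
Proof.
elim: k f g => [|k IH] f g.
  by move=> [cf _] [cg _]; split=> // p; apply: continuousM; [exact: cf|exact: cg].
move=> Cf1 Cg1; have [Cf0 Cg0] := (CkW Cf1, CkW Cg1).
case: Cf1 Cg1 => [cf Df] [cg Dg]; split=> [p|i].
  by apply: continuousM; [exact: cf|exact: cg].
have [[df Cf] [dg Cg]] := (Df i, Dg i).
split=> [p|]; first exact: derivableM.
suff -> : 'D_(evec i) (f * g) = f * 'D_(evec i) g + g * 'D_(evec i) f.
  by apply: CkD; exact: IH.
by apply/funext => p; rewrite deriveM.
Qed.

Lemma CkN k f : Ck k f -> Ck k (- f).
Proof.
move=> Cf; suff -> : - f = cst (-1) * f by apply: CkM => //; exact: Ck_cst.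
by apply/funext => p; rewrite !fctE mulN1r.
Qed.

Definition smooth_pred : {pred V -> R} := fun f => `[< smooth f >].

Lemma smooth_subring : subring_closed smooth_pred.
Proof.
split=> [|f g /asboolP sf /asboolP sg|f g /asboolP sf /asboolP sg];
  apply/asboolP => k.
- exact: Ck_cst.
- by apply: CkD => //; exact: CkN.
- exact: CkM.
Qed.
HB.instance Definition _ :=
  GRing.isSubringClosed.Build (V -> R) smooth_pred smooth_subring.

Record Cinf := MkCinf {
  Cinf_fun :> V -> R;
  Cinf_smooth : Cinf_fun \in smooth_pred }.
HB.instance Definition _ := [isSub for Cinf_fun].
HB.instance Definition _ := [Choice of Cinf by <:].
HB.instance Definition _ := [SubChoice_isSubComNzRing of Cinf by <:].

Lemma CinfP (f g : Cinf) : (forall p, f p = g p) -> f = g.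
Proof. by move=> fg; apply/val_inj/funext. Qed.

Lemma smoothP (f : Cinf) : smooth f.
Proof. by apply/asboolP; exact: (valP f). Qed.

Lemma Cinf_derivable (f : Cinf) p i : derivable f p (evec i).
Proof. by have [_ /(_ i)[]] := smoothP f 1%N. Qed.

Lemma smooth_partial (f : Cinf) i : 'D_(evec i) f \in smooth_pred.
Proof. by apply/asboolP => k; have [_ /(_ i)[]] := smoothP f k.+1. Qed.

End SmoothFunctions.

HB.lock Definition partial (R : realType) (n : nat) (i : 'I_n) (f : Cinf R n)
  : Cinf R n := MkCinf (smooth_partial f i).

Section PartialDerivatives.
Variables (R : realType) (n : nat).
Local Notation V := 'rV[R]_n.
Local Notation Cinf := (Cinf R n).
Implicit Types (i : 'I_n) (f g : Cinf).

Lemma partialE i f p : partial i f p = 'D_(evec R i) f p.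
Proof. by rewrite partial.unlock. Qed.

Lemma partialD i : {morph @partial R n i : f g / f + g}.
Proof.
move=> f g; apply: CinfP => p.
rewrite -[RHS]/(partial i f p + partial i g p) !partialE.
rewrite -[LHS]/('D_(evec R i) ((f : V -> R) + (g : V -> R)) p).
by rewrite deriveD//; exact: Cinf_derivable.
Qed.

Lemma partialM i f g : partial i (f * g) = f * partial i g + g * partial i f.
Proof.
apply: CinfP => p.
rewrite -[RHS]/(f p * partial i g p + g p * partial i f p) !partialE.
rewrite -[LHS]/('D_(evec R i) ((f : V -> R) * (g : V -> R)) p).
by rewrite deriveM//; exact: Cinf_derivable.
Qed.

Lemma partialB i : zmod_morphism (@partial R n i).
Proof.
move=> f g; apply: (addIr (partial i g)).
by rewrite -partialD !addrNK.
Qed.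
HB.instance Definition _ i :=
  GRing.isZmodMorphism.Build Cinf Cinf (@partial R n i) (@partialB i).

Lemma partial1 i : partial i (1 : Cinf) = 0.
Proof.
apply: CinfP => p; rewrite partialE.
by rewrite -[LHS]/('D_(evec R i) (cst 1 : V -> R) p) derive_cst.
Qed.

Lemma smooth_coord (j : 'I_n) : (fun p : V => p 0 j) \in @smooth_pred R n.
Proof.
pose c : V -> R := fun p => p 0 j.
have cc : continuous c by exact: coord_continuous.
have lc : linear c by move=> a u v; rewrite /c !mxE.
pose cL : {linear V -> R} := HB.pack c (GRing.isLinear.Build _ _ _ _ c lc).
have dc p : differentiable cL p by exact: linear_differentiable.
rewrite -/c; apply/asboolP => -[|k] //; split=> // i; split=> [p|].
  exact: diff_derivable (dc p).
rewrite (_ : 'D_(evec R i) c = cst (evec R i 0 j)); first exact: Ck_cst.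
apply/funext => p; transitivity ('d cL p (evec R i)); first exact: deriveE.
by rewrite diff_lin.
Qed.

Definition coord (j : 'I_n) : Cinf := MkCinf (smooth_coord j).

End PartialDerivatives.

(* P I is the coefficient of d_{i1} /\ ... /\ d_{ik}, where i1 < ... < ik are
   the elements of I; multivector fields of mixed degree are allowed. *)
Definition mvfield (R : realType) (n : nat) : Type :=
  {ffun {set 'I_n} -> Cinf R n}.

HB.instance Definition _ R n := GRing.Zmodule.on (mvfield R n).

(* Locked, as are the partial derivatives, because unification would otherwise
   unfold these operations down to the reals. *)
HB.lock Definition mvscale (R : realType) (n : nat) (f : Cinf R n)
  (P : mvfield R n) : mvfield R n := [ffun I => f * P I].

Lemma mvscaleE R n (f : Cinf R n) (P : mvfield R n) I :
  mvscale f P I = f * P I.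
Proof. by rewrite mvscale.unlock ffunE. Qed.

Section MultivectorModule.
Variables (R : realType) (n : nat).

Let mvscaleA (f g : Cinf R n) (P : mvfield R n) :
  mvscale f (mvscale g P) = mvscale (f * g) P.
Proof. by apply/ffunP => I; rewrite !mvscaleE mulrA. Qed.
Let mvscale1 : left_id 1 (@mvscale R n).
Proof. by move=> P; apply/ffunP => I; rewrite mvscaleE mul1r. Qed.
Let mvscaleDr : right_distributive (@mvscale R n) +%R.
Proof.
by move=> f P Q; apply/ffunP => I; rewrite ffunE !mvscaleE ffunE mulrDr.
Qed.
Let mvscaleDl (P : mvfield R n) : {morph (@mvscale R n)^~ P : f g / f + g}.
Proof.
by move=> f g; apply/ffunP => I; rewrite ffunE !mvscaleE mulrDl.
Qed.
HB.instance Definition _ := GRing.Zmodule_isLmodule.Build (Cinf R n)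
  (mvfield R n) mvscaleA mvscale1 mvscaleDr mvscaleDl.

Lemma mvfieldZE (f : Cinf R n) (P : mvfield R n) I : (f *: P) I = f * P I.
Proof. exact: mvscaleE. Qed.

End MultivectorModule.

Section MultivectorFields.
Variables (R : realType) (n : nat).
Implicit Types (P Q : mvfield R n) (I J K : {set 'I_n}) (f : Cinf R n).

Definition homogeneous (k : nat) P : Prop := forall I, #|I| != k -> P I = 0.

(* mvbasis [set i1; ...; ik] is d_{i1} /\ ... /\ d_{ik} for i1 < ... < ik;
   in particular, mvbasis finset.set0 is the constant function 1. *)
Definition mvbasis I : mvfield R n := [ffun J => (J == I)%:R].

Definition inversions I J : nat :=
  #|[set ij : 'I_n * 'I_n | [&& ij.1 \in I, ij.2 \in J & (ij.2 < ij.1)%N]]|.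

Definition wedge P Q : mvfield R n :=
  [ffun K : {set 'I_n} => \sum_(I : {set 'I_n} | I \subset K)
     (-1) ^+ inversions I (K :\: I) * (P I * Q (K :\: I))].

Definition mvpartial (i : 'I_n) P : mvfield R n :=
  [ffun K => partial i (P K)].

(* The right and left derivatives with respect to the odd variable d_i:
   d_K /\ d_i |-> d_K and d_i /\ d_K |-> d_K, for i not in K. *)
Definition odd_deriv_r (i : 'I_n) P : mvfield R n :=
  [ffun K : {set 'I_n} => if i \in K then 0 else
     (-1) ^+ inversions K [set i] * P (i |: K)].
Definition odd_deriv_l (i : 'I_n) P : mvfield R n :=
  [ffun K : {set 'I_n} => if i \in K then 0 else
     (-1) ^+ inversions [set i] K * P (i |: K)].

(* The Schouten-Nijenhuis bracket, with the convention that
   [P, Q /\ S] = [P, Q] /\ S + (-1)^((p - 1) q) Q /\ [P, S] and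
   [P, Q] = - (-1)^((p - 1) (q - 1)) [Q, P] for P, Q of degrees p, q.
   In the second term, using the left derivative and this order of the factors
   absorbs the sign (-1)^((p - 1) (q - 1)) of the usual coordinate formula. *)
Definition schouten P Q : mvfield R n :=
  \sum_(i < n) (wedge (odd_deriv_r i P) (mvpartial i Q)
                - wedge (mvpartial i P) (odd_deriv_l i Q)).

Definition poisson (pi : mvfield R n) : Prop :=
  homogeneous 2 pi /\ schouten pi pi = 0.

Lemma wedgeBr P : zmod_morphism (wedge P).
Proof.
move=> Q S; apply/ffunP => K; rewrite !ffunE -sumrB; apply: eq_bigr => I _.
by rewrite !ffunE mulrBr mulrBr.
Qed.
HB.instance Definition _ P :=
  GRing.isZmodMorphism.Build (mvfield R n) (mvfield R n) (wedge P) (wedgeBr P).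

Lemma wedgeZr P f Q : wedge P (f *: Q) = f *: wedge P Q.
Proof.
apply/ffunP => K; rewrite mvfieldZE !ffunE mulr_sumr; apply: eq_bigr => I _.
by rewrite mvfieldZE (mulrCA (P I)) (mulrCA _ f).
Qed.

Lemma wedgeZl P f Q : wedge (f *: P) Q = f *: wedge P Q.
Proof.
apply/ffunP => K; rewrite mvfieldZE !ffunE mulr_sumr; apply: eq_bigr => I _.
by rewrite mvfieldZE -(mulrA f) (mulrCA _ f).
Qed.

Lemma wedge_suml (s : 'I_n -> mvfield R n) Q :
  wedge (\sum_i s i) Q = \sum_i wedge (s i) Q.
Proof.
apply/ffunP => K; rewrite sum_ffunE !ffunE.
under [RHS]eq_bigr do rewrite ffunE.
rewrite [RHS]exchange_big; apply: eq_bigr => I _.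
by rewrite sum_ffunE mulr_suml mulr_sumr.
Qed.

Lemma wedge1r P : wedge P (mvbasis finset.set0) = P.
Proof.
apply/ffunP => K; rewrite !ffunE (bigD1 K)//= big1 => [|I /andP[IK neIK]].
  rewrite finset.setDv !ffunE eqxx addr0 mulr1.
  rewrite /inversions (_ : [set _ | _] = finset.set0) ?cards0 ?mul1r//.
  by apply/setP => ij; rewrite !inE andbF.
rewrite !ffunE (_ : _ == finset.set0 = false) ?mulr0//.
apply/negP; rewrite finset.setD_eq0 => KI; move/negP: neIK; apply.
by rewrite finset.eqEsubset IK.
Qed.

Lemma mvpartialB i : zmod_morphism (mvpartial i).
Proof. by move=> P Q; apply/ffunP => K; rewrite !ffunE raddfB. Qed.

Lemma mvpartialZ i f P :
  mvpartial i (f *: P) = partial i f *: P + f *: mvpartial i P.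
Proof.
apply/ffunP => K; rewrite !ffunE !mvfieldZE ffunE partialM addrC.
by rewrite (mulrC (P K)).
Qed.

Lemma odd_deriv_lB i : zmod_morphism (odd_deriv_l i).
Proof.
move=> P Q; apply/ffunP => K; rewrite !ffunE.
by case: ifP => _; rewrite ?subr0// mulrBr.
Qed.

Lemma odd_deriv_lZ i f P : odd_deriv_l i (f *: P) = f *: odd_deriv_l i P.
Proof.
apply/ffunP => K; rewrite mvfieldZE !ffunE.
by case: ifP => _; rewrite ?mulr0// mvfieldZE (mulrCA _ f).
Qed.

Lemma schoutenB P : zmod_morphism (schouten P).
Proof.
move=> Q S; rewrite -sumrB; apply: eq_bigr => i _.
rewrite mvpartialB odd_deriv_lB wedgeBr wedgeBr.
by rewrite !opprB addrACA [RHS]addrACA; congr (_ + _); rewrite addrC.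
Qed.
HB.instance Definition _ P :=
  GRing.isZmodMorphism.Build (mvfield R n) (mvfield R n) (schouten P)
    (schoutenB P).

Lemma odd_deriv_l_fun i f : odd_deriv_l i (f *: mvbasis finset.set0) = 0.
Proof.
apply/ffunP => K; rewrite !ffunE; case: ifP => // _.
rewrite mvfieldZE ffunE (_ : (i |: K == finset.set0) = false) ?mulr0//.
by apply/negP => /eqP/setP/(_ i); rewrite !inE eqxx.
Qed.

Lemma schouten_fun P f :
  schouten P (f *: mvbasis finset.set0) = \sum_i partial i f *: odd_deriv_r i P.
Proof.
apply: eq_bigr => i _.
rewrite odd_deriv_l_fun raddf0 subr0 mvpartialZ (_ : mvpartial i _ = 0).
  by rewrite scaler0 addr0 wedgeZr wedge1r.
apply/ffunP => K; rewrite !ffunE.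
by case: (K == finset.set0); [exact: partial1|exact: raddf0].
Qed.

Lemma schoutenZr P f Q :
  schouten P (f *: Q) =
  wedge (schouten P (f *: mvbasis finset.set0)) Q + f *: schouten P Q.
Proof.
rewrite schouten_fun wedge_suml scaler_sumr -big_split; apply: eq_bigr => i _ /=.
rewrite mvpartialZ raddfD odd_deriv_lZ /= !wedgeZr wedgeZl scalerBr.
by rewrite addrA.
Qed.

End MultivectorFields.

Section PoissonCohomology.
Variables (R : realType) (n : nat) (pi : mvfield R n).
Local Notation Cinf := (Cinf R n).
Local Notation mvfield := (mvfield R n).

Definition casimir_pred : {pred Cinf} :=
  fun f => schouten pi (f *: mvbasis R finset.set0) == 0.

Lemma schouten_casimirZ f P :
  f \in casimir_pred -> schouten pi (f *: P) = f *: schouten pi P.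
Proof.
move=> /eqP cf; rewrite schoutenZr cf.
by rewrite -(scale0r (0 : mvfield)) wedgeZl !scale0r add0r.
Qed.

Lemma casimir_subring : subring_closed casimir_pred.
Proof.
split=> [|f g /eqP cf /eqP cg|f g cf /eqP cg]; apply/eqP.
- rewrite schouten_fun big1// => i _.
  by rewrite partial1 scale0r.
- by rewrite scalerBl raddfB /= cf cg subr0.
- by rewrite -scalerA schouten_casimirZ// cg scaler0.
Qed.
HB.instance Definition _ :=
  GRing.isSubringClosed.Build Cinf casimir_pred casimir_subring.

(* The ring of Casimir functions, i.e. H^0(R^n, pi). *)
Record casimir := MkCasimir {
  casimir_fun :> Cinf;
  casimirP : casimir_fun \in casimir_pred }.
HB.instance Definition _ := [isSub for casimir_fun].
HB.instance Definition _ := [Choice of casimir by <:].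
HB.instance Definition _ := [SubChoice_isSubComNzRing of casimir by <:].

(* An alias of mvfield, with scalars restricted to the Casimir functions. *)
Definition cas_mvfield := mvfield.
HB.instance Definition _ := GRing.Zmodule.on cas_mvfield.

Definition cas_scale (f : casimir) (P : cas_mvfield) : cas_mvfield :=
  casimir_fun f *: (P : mvfield).

Let cas_scaleA f g P : cas_scale f (cas_scale g P) = cas_scale (f * g) P.
Proof. exact: scalerA. Qed.
Let cas_scale1 : left_id 1 cas_scale.
Proof. exact: scale1r. Qed.
Let cas_scaleDr : right_distributive cas_scale +%R.
Proof. by move=> f; exact: scalerDr. Qed.
Let cas_scaleDl P : {morph cas_scale^~ P : f g / f + g}.
Proof. by move=> f g; exact: scalerDl. Qed.
HB.instance Definition _ := GRing.Zmodule_isLmodule.Build casimir cas_mvfield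
  cas_scaleA cas_scale1 cas_scaleDr cas_scaleDl.

Definition cocycle_pred (k : nat) : {pred cas_mvfield} :=
  fun P => `[< homogeneous k P /\ schouten pi P = 0 >].

Lemma cocycle_submod k : submod_closed (cocycle_pred k).
Proof.
split=> [|f P Q /asboolP[hP dP] /asboolP[hQ dQ]]; apply/asboolP.
  by split=> [I _|]; [rewrite ffunE|rewrite raddf0].
split=> [I Ik|].
  by rewrite ffunE [X in X + _]mvfieldZE hP// hQ// mulr0 addr0.
rewrite [LHS](raddfD (schouten pi)) /= dQ addr0.
by rewrite schouten_casimirZ ?casimirP// dP scaler0.
Qed.
HB.instance Definition _ k :=
  GRing.isSubmodClosed.Build casimir cas_mvfield (cocycle_pred k)
    (cocycle_submod k).

Record cocycle (k : nat) := MkCocycle {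
  cocycle_field : cas_mvfield;
  cocycleP : cocycle_field \in cocycle_pred k }.
HB.instance Definition _ k := [isSub for @cocycle_field k].
HB.instance Definition _ k := [Choice of cocycle k by <:].
HB.instance Definition _ k := [SubChoice_isSubLmodule of cocycle k by <:].

(* Q ranges over the fields of degree k - 1; if k = 0, then Q = 0. When pi is
   Poisson, every such [pi, Q] is a cocycle. *)
Definition coboundary_pred (k : nat) : {pred cocycle k} :=
  fun P => `[< exists2 Q : mvfield,
    (forall I : {set 'I_n}, #|I|.+1 != k -> Q I = 0) &
    cocycle_field P = schouten pi Q >].

Lemma coboundary_submod k : submod_closed (@coboundary_pred k).
Proof.
split=> [|f P P' /asboolP[Q hQ PQ] /asboolP[Q' hQ' PQ']]; apply/asboolP.
  by exists 0 => [I _|]; [rewrite ffunE|rewrite raddf0].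
exists ((f : Cinf) *: Q + Q') => [I Ik|].
  by rewrite ffunE mvfieldZE hQ// hQ'// mulr0 addr0.
by rewrite raddfD /= schouten_casimirZ ?casimirP// -PQ -PQ'.
Qed.
HB.instance Definition _ k :=
  GRing.isSubmodClosed.Build casimir (cocycle k) (@coboundary_pred k)
    (@coboundary_submod k).

Definition cohomology (k : nat) : lmodType casimir :=
  quotmod (@coboundary_pred k).

Definition cohom_class (k : nat) (P : cocycle k) : cohomology k :=
  proj_quotmod (@coboundary_pred k) P.

(* The operation op on multivector fields induces a well-defined operation
   H^k x H^l -> H^(deg k l) on cohomology. *)
Definition descends (op : mvfield -> mvfield -> mvfield)
    (deg : nat -> nat -> nat) : Prop :=
  forall k l : nat,
  exists opH : cohomology k -> cohomology l -> cohomology (deg k l),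
  forall (P : cocycle k) (Q : cocycle l),
  exists2 S : cocycle (deg k l),
    cocycle_field S = op (cocycle_field P) (cocycle_field Q) &
    opH (cohom_class P) (cohom_class Q) = cohom_class S.

Definition casimir_span (s : seq mvfield) (P : mvfield) : Prop :=
  exists c : 'I_(size s) -> casimir, P = \sum_i (c i : Cinf) *: s`_i.

End PoissonCohomology.

Definition ix : 'I_3 := @Ordinal 3 0 isT.
Definition iy : 'I_3 := @Ordinal 3 1 isT.
Definition iz : 'I_3 := @Ordinal 3 2 isT.

Definition vfield (R : realType) (i : 'I_3) : mvfield R 3 := mvbasis R [set i].

Definition aff_poisson (R : realType) : mvfield R 3 :=
  coord R ix *: wedge (vfield R ix) (vfield R iy).

(* Main.v *)
Require Import Defs.
From HB Require Import structures.
From mathcomp Require Import all_boot all_order all_algebra.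
From mathcomp Require Import all_classical all_reals all_analysis.
From mathcomp Require Import ring.

Set Implicit Arguments.
Unset Strict Implicit.
Unset Printing Implicit Defensive.

Import Order.TTheory GRing.Theory Num.Theory.
Import numFieldNormedType.Exports.
Local Open Scope ring_scope.

(* In coordinates, d_pi of (a, b, c) := a d_x + b d_y + c d_z is
   (x a_x + x b_y - a) d_x^d_y + x c_y d_x^d_z - x c_x d_y^d_z, and the last
   two components of a bivector field obey the same system as (a, b).  If
   x (a_x + b_y) = a, then u := a_x + b_y is smooth with a = x u and
   b_y = - x u_x, so integrating u in y gives a potential f with a = x f_y and
   b = b(0, 0, z) - x f_x; the restriction to x = 0 detects the remaining
   class. The component along d_x^d_y (resp. d_x^d_y^d_z) is always exact, as
   u d_x^d_y = d_pi (- u d_x + (\int_0^y u_x) d_y).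
   Smooth primitives are the coordinate y times the mean value
   \int_0^1 u(x, t y, z) dt, which also yields the symmetry of second partial
   derivatives.
   The operations descend because d_pi (P ^ Q) = d_pi P ^ Q + sP ^ d_pi Q and
   d_pi [P, Q] = [d_pi P, Q] - [sP, d_pi Q], where s is the sign (-1)^deg. *)

(** * Integrals depending on a parameter *)

Section ParametricIntegral.
Local Open Scope classical_set_scope.
Variable R : realType.
Local Notation mu := (@lebesgue_measure R).

(** Both derivatives are limits of the same difference quotient. This brings one-variable results to
    bear on directional derivatives; [is_derive_line0] is the way back, at [s = 0]. *)
Lemma is_derive_line (V : normedModType R) (f : V -> R) (q v : V) (s : R) :
  derivable f (q + s *: v) v ->
  is_derive s 1 (fun s => f (q + s *: v)) ('D_v f (q + s *: v)).
Proof.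
have quotE : (fun h : R => h^-1 *: (f (q + (h *: 1 + s) *: v) - f (q + s *: v)))
    = (fun h : R => h^-1 *: (f (h *: v + (q + s *: v)) - f (q + s *: v))).
  by apply/funext => h; rewrite scaler1 scalerDl addrCA.
move=> df; apply: DeriveDef; first by rewrite /derivable /= quotE.
by rewrite /derive /= quotE.
Qed.

Lemma is_derive_line0 (V : normedModType R) (f : V -> R) (q v : V) (df : R) :
  is_derive (0 : R) 1 (fun s => f (q + s *: v)) df -> is_derive q v f df.
Proof.
have quotE :
    (fun h : R =>
      h^-1 *: (f (q + (h *: 1 + (0 : R)) *: v) - f (q + (0 : R) *: v)))
    = (fun h : R => h^-1 *: (f (h *: v + q) - f q)).
  by apply/funext => h; rewrite scaler1 addr0 scale0r addr0 (addrC q).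
move=> [dl El]; apply: DeriveDef.
  by move: dl; rewrite /derivable /= quotE.
by rewrite -El /derive /= quotE.
Qed.

Local Notation I01 := (`[0%R, 1%R]%classic : set R).

Lemma section_continuous (V : topologicalType) (f : V * R -> R) (p : V) :
  continuous f -> continuous (fun t => f (p, t)).
Proof.
move=> cf t; have cp : (fun s : R => (p, s)) @ t --> (p, t).
  by apply: (cvg_pair (cvg_cst p) cvg_id).
by apply: (cvg_comp _ _ cp); exact: cf.
Qed.
Arguments section_continuous {V f} p cf.

(** A tube argument: compactness of the unit interval makes the neighbourhood of [p] independent of
    [t]. *)
Lemma near_unif01 (V : normedModType R) (f : V * R -> R) (p : V) (e : R) :
  continuous f -> 0 < e ->
  \forall q \near p, forall t, I01 t -> `|f (q, t) - f (p, t)| < e.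
Proof.
move=> cf e0.
have /compact_near_coveringP cov := @segment_compact R 0 1.
have := cov V (nbhs p) (fun q t => `|f (q, t) - f (p, t)| < e) (nbhs_filter p).
apply => t t01 /=.
have e20 : 0 < e / 2 by rewrite divr_gt0.
have /cvgrPdist_lt /(_ _ e20) H1 := cf (p, t).
have cpt := section_continuous p cf t.
have /cvgrPdist_lt /(_ _ e20) H2 := cpt.
move: H1 => -[[A B] /= [nA nB] AB].
near=> s q => /=.
(* Both [f (q, s)] and [f (p, s)] are within [e / 2] of [f (p, t)]. *)
rewrite (le_lt_trans (ler_distD (f (p, t)) _ _))// [ltRHS]splitr ltrD//.
  rewrite distrC; apply: (AB (q, s)); split => /=; first by near: q.
  by near: s.
by near: s.
Unshelve. all: by end_near. Qed.

Lemma integrable01 (g : R -> R) :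
  continuous g -> mu.-integrable I01 (EFin \o g).
Proof.
move=> cg; apply: continuous_compact_integrable; first exact: segment_compact.
exact: continuous_subspaceT.
Qed.

Section Param.
Variables (V : normedModType R) (f : V * R -> R).
Hypothesis cf : continuous f.

Definition avg p : R := \int[mu]_(t in I01) f (p, t).

Lemma avg_continuous : continuous avg.
Proof.
move=> p; apply/cvgrPdist_le => e e0.
near=> q.
have H : forall t, I01 t -> `|f (q, t) - f (p, t)| < e.
  by near: q; exact: near_unif01.
rewrite distrC /avg -RintegralB//;
  [|exact: integrable01 (section_continuous _ cf)..].
have iB : mu.-integrable I01 (EFin \o (fun t => f (q, t) - f (p, t))).
  apply: integrable01 => t.
  by apply: cvgB; exact: section_continuous.
apply: (le_trans (le_normr_Rintegral _ iB)) => //.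
(* The unit interval has measure 1, so the uniform bound passes to the integral unchanged. *)
have -> : e = \int[mu]_(t in I01) (cst e t).
  rewrite Rintegral_cst//= lebesgue_measure_itv/=.
  by rewrite lte_fin ltr01 oppr0 addr0 mulr1.
apply: le_Rintegral => //.
- apply: integrable01 => t.
  by apply: cvg_norm; apply: cvgB; exact: section_continuous.
- by apply: integrable01 => t; exact: cvg_cst.
- by move=> t /H /ltW.
Unshelve. all: by end_near. Qed.

End Param.

(** Supplies the dominating constant for differentiation under the integral: the maximum of the
    section at [p], plus 1 for the variation in [q]. *)
Lemma section_bounded01 (V : normedModType R) (f : V * R -> R) (p : V) :
  continuous f ->
  exists2 M : R, 0 <= M &
    \forall q \near p, forall t, I01 t -> `|f (q, t)| <= M.
Proof.
move=> cf.
have cn : {within `[0%R, 1%R], continuous (fun t => `|f (p, t)|)}.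
  apply: continuous_subspaceT => t.
  by apply: cvg_norm; exact: section_continuous.
have [c _ cM] := EVT_max ler01 cn.
exists (`|f (p, c)| + 1); first by rewrite addr_ge0.
near=> q => t t01.
have H : forall t, I01 t -> `|f (q, t) - f (p, t)| < 1.
  by near: q; exact: near_unif01.
rewrite -(subrK (f (p, t)) (f (q, t))) addrC.
by rewrite (le_trans (ler_normD _ _))// lerD ?cM// ltW// H.
Unshelve. all: by end_near. Qed.

(** Restricting to the line [p + s *: v] leaves a single real parameter, to which dominated
    differentiation under the integral applies. *)
Lemma is_derive_avg (V : normedModType R) (f f' : V * R -> R) (v : V) (p : V) :
  continuous f -> continuous f' ->
  (forall q t, is_derive q v (fun q => f (q, t)) (f' (q, t))) ->
  is_derive p v (avg f) (avg f' p).
Proof.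
move=> cf cf' df; apply: is_derive_line0.
have [M M0 nM] := section_bounded01 p cf'.
have cl : (fun s : R => p + s *: v) @ (0 : R) --> p.
  rewrite -{2}[p]addr0 -(scale0r v); apply: cvgD; first exact: cvg_cst.
  by apply: cvgZr_tmp; exact: cvg_id.
(* Pulled back along the line, the neighbourhood of [p] contains an interval of radius [d], on which
   [M] dominates the derivative. *)
have /cl := nM; rewrite /= => -[d /= d0 dM].
pose g (s t : R) := f (p + s *: v, t).
have gd (s t : R) : is_derive s (1 : R) (g ^~ t) (f' (p + s *: v, t)).
  have [dd Ed] := df (p + s *: v) t.
  rewrite -Ed; exact: (@is_derive_line _ (fun q => f (q, t)) p v s dd).
have I0 : (`](- d), d[%classic : set R) 0 by rewrite /= in_itv/= oppr_lt0 d0.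
have intg s : (`](- d), d[%classic : set R) s ->
    mu.-integrable I01 (EFin \o g s).
  by move=> _; apply: integrable01; exact: section_continuous.
have derg s t : (`](- d), d[%classic : set R) s -> I01 t ->
    derivable (g ^~ t) s 1.
  by move=> _ _; have [] := gd s t.
have intM : mu.-integrable I01 (EFin \o cst M).
  by apply: integrable01 => t; exact: cvg_cst.
have gE s t : partial1of2 g s t = f' (p + s *: v, t).
  by rewrite partial1of2E; have [_ ->] := gd s t.
have ubg s t : (`](- d), d[%classic : set R) s -> I01 t ->
    `|partial1of2 g s t| <= M.
  move=> sd t01; rewrite gE; apply: dM => //=.
  by rewrite sub0r normrN ltr_norml; move: sd; rewrite /= in_itv.
have mI : measurable I01 by [].
apply: DeriveDef.
  exact: (@derivable_under_integral R _ _ mu g I01 mI 0 (- d) d I0 intg derg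
    (cst M) (fun=> M0) intM ubg).
rewrite -derive1E.
rewrite [LHS](@differentiation_under_integral R _ _ mu g I01 mI 0 (- d) d I0
    intg derg
    (cst M) (fun=> M0) intM ubg).
by apply: eq_Rintegral => t _; rewrite gE scale0r addr0.
Qed.

End ParametricIntegral.

(** * Smooth primitives along a coordinate *)

Section CoordinateScaling.
Local Open Scope classical_set_scope.
Variables (R : realType) (n : nat).
Local Notation mu := (@lebesgue_measure R).
Local Notation V := 'rV[R]_n.
Local Notation Cinf := (Cinf R n).
Local Notation evec := (evec R).
Local Notation coord := (@Defs.coord R n).
Implicit Types (F : Cinf) (p q : V) (i j : 'I_n) (s t : R).

(** Multiplies coordinate [j] by [t] and fixes the others: the identity at [t = 1], the projection
    onto the hyperplane where coordinate [j] vanishes at [t = 0]. *)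
Definition scale_coord j t p : V := p + ((t - 1) * p 0 j) *: evec j.

(** The exponent [i == j] is a boolean read as 0 or 1, so one formula covers the scaled direction
    and the others. *)
Lemma scale_coord_line i j t p s :
  scale_coord j t (p + s *: evec i) =
  scale_coord j t p + (s * t ^+ (i == j)) *: evec i.
Proof.
rewrite /scale_coord -!addrA; congr (_ + _).
rewrite !mxE eqxx /= mulrDr scalerDl addrCA; congr (_ + _).
have [->|ij] := eqVneq i j.
  by rewrite mulr1 expr1 -scalerDl mulrBl mul1r addrC subrK mulrC.
by rewrite !mulr0 scale0r addr0 expr0 mulr1.
Qed.

Lemma scale_coord_origin j t p :
  scale_coord j t p = scale_coord j 0 p + (t * p 0 j) *: evec j.
Proof.
by rewrite /scale_coord -addrA -scalerDl -mulrDl sub0r (addrC (- 1)).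
Qed.

Lemma scale_coord1 j p : scale_coord j 1 p = p.
Proof. by rewrite /scale_coord subrr mul0r scale0r addr0. Qed.

Lemma scale_coord_continuous j :
  continuous (fun pt : V * R => scale_coord j pt.2 pt.1).
Proof.
have c1 : continuous (fst : V * R -> V) by move=> pt; exact: cvg_fst.
have c2 : continuous (snd : V * R -> R) by move=> pt; exact: cvg_snd.
have cj : continuous (fun pt : V * R => pt.1 0 j).
  move=> pt; apply: (cvg_comp fst (fun p : V => p 0 j) (c1 pt)).
  exact: coord_continuous.
move=> pt; apply: (cvgD (c1 pt)); apply: cvgZr_tmp.
by apply: (cvgM _ (cj pt)); apply: (cvgB (c2 pt)); exact: cvg_cst.
Qed.

Lemma scale_coordl_continuous j t : continuous (scale_coord j t).
Proof.
move=> p; have cp : (fun q : V => (q, t)) @ p --> (p, t).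
  have := @cvg_pair V V R (nbhs p) (nbhs p) (nbhs t) _ _ _ id (cst t) cvg_id
    (cvg_cst t).
  exact.
apply: (cvg_comp _ (fun pt : V * R => scale_coord j pt.2 pt.1) cp).
exact: (@scale_coord_continuous j (p, t)).
Qed.

Lemma is_derive_scale_coord i j t F p :
  is_derive p (evec i) (F \o scale_coord j t)
    (t ^+ (i == j) * partial i F (scale_coord j t p)).
Proof.
apply: is_derive_line0.
have -> : (fun s => (F \o scale_coord j t) (p + s *: evec i)) =
    (fun s => F (scale_coord j t p + s *: evec i)) \o ( *%R^~ (t ^+ (i == j))).
  by apply/funext => s /=; rewrite scale_coord_line.
rewrite mulrC; apply: is_derive1_comp; last first.
  have := @is_deriveZ R R R id (t ^+ (i == j)) 0 1 1 (is_derive_id _ _).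
  rewrite /GRing.scale /= mulr1; congr is_derive; apply/funext => s /=.
  by rewrite mulrC.
have := @is_derive_line R V F (scale_coord j t p) (evec i) 0
  (@Cinf_derivable R n F _ i).
by rewrite mul0r scale0r addr0 -partialE.
Qed.

Lemma Cinf_continuous F : continuous F.
Proof. exact: Ck_cont (smoothP F 0). Qed.

(** The induction is on the order for all [F] at once, since a partial derivative of a restriction
    is a constant times the restriction of a partial derivative. *)
Lemma smooth_restrict F j : F \o scale_coord j 0 \in @smooth_pred R n.
Proof.
apply/asboolP => k; elim: k F => [|k IH] F;
  have cF : continuous (F \o scale_coord j 0).
- move=> p; apply: continuous_comp; last exact: Cinf_continuous.
  exact: scale_coordl_continuous.
- by split.
- move=> p; apply: continuous_comp; last exact: Cinf_continuous.
  exact: scale_coordl_continuous.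
split=> // i; split=> [p|].
  by have [] := is_derive_scale_coord i j 0 F p.
have -> : 'D_(evec i) (F \o scale_coord j 0) =
    cst (0 ^+ (i == j)) * (partial i F \o scale_coord j 0).
  by apply/funext => p; have [_ ->] := is_derive_scale_coord i j 0 F p.
by apply: CkM => //; exact: Ck_cst.
Qed.

Definition restr j F : Cinf := MkCinf (smooth_restrict F j).

(** The weight [t ^+ m] closes the family under differentiation: each derivative in direction [j]
    produces one more factor [t]. *)
Definition scaled j m F (pt : V * R) : R :=
  pt.2 ^+ m * F (scale_coord j pt.2 pt.1).

Lemma scaled_continuous j m F : continuous (scaled j m F).
Proof.
have c2 : continuous (snd : V * R -> R) by move=> pt; exact: cvg_snd.
have cF : continuous (fun pt : V * R => F (scale_coord j pt.2 pt.1)).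
  move=> pt; apply: (cvg_comp _ F (@scale_coord_continuous j pt)).
  exact: Cinf_continuous.
move=> pt; apply: (cvgM _ (cF pt)).
apply: (cvg_comp _ (fun t : R => t ^+ m) (c2 pt)); exact: exprn_continuous.
Qed.

Lemma is_derive_avg_scaled i j m F p :
  is_derive p (evec i) (avg (scaled j m F))
    (avg (scaled j (m + (i == j)) (partial i F)) p).
Proof.
apply: is_derive_avg; [exact: scaled_continuous..|] => q t.
rewrite /scaled /= exprD -mulrA.
have := @is_deriveZ R V R _ (t ^+ m) _ _ _ (is_derive_scale_coord i j t F q).
exact.
Qed.

Lemma smooth_avg_scaled j m F : avg (scaled j m F) \in @smooth_pred R n.
Proof.
apply/asboolP => k; elim: k m F => [|k IH] m F.
  by split=> //; exact: avg_continuous (@scaled_continuous j m F).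
split=> [|i]; first exact: avg_continuous (@scaled_continuous j m F).
split=> [p|]; first by have [] := is_derive_avg_scaled i j m F p.
have -> : 'D_(evec i) (avg (scaled j m F)) =
    avg (scaled j (m + (i == j)) (partial i F)).
  by apply/funext => p; have [_ ->] := is_derive_avg_scaled i j m F p.
exact: IH.
Qed.

Definition average j m F : Cinf := MkCinf (smooth_avg_scaled j m F).

Lemma partial_average i j m F :
  partial i (average j m F) = average j (m + (i == j)) (partial i F).
Proof.
apply: CinfP => p; rewrite partialE.
by have [_ ->] := is_derive_avg_scaled i j m F p.
Qed.

Lemma partial_restr i j F :
  partial i (restr j F) = if i == j then 0 else restr j (partial i F).
Proof.
apply: CinfP => p; rewrite partialE.
have [_ ->] := is_derive_scale_coord i j 0 F p.
by case: (i == j); rewrite ?mul0r ?mul1r.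
Qed.

Lemma partial_coord i j : partial i (coord j) = (i == j)%:R.
Proof.
apply: CinfP => p; rewrite partialE.
have H : is_derive p (evec i) (coord j) (i == j)%:R.
  apply: is_derive_line0.
  have := @is_deriveD R R R (cst (p 0 j)) _ 0 1 _ _ (is_derive_cst _ _ _)
   (@is_deriveZ R R R id ((i == j)%:R) 0 1 1 (is_derive_id _ _)).
  rewrite add0r /GRing.scale /= mulr1; congr is_derive; apply/funext => s /=.
  by rewrite !mxE eqxx /= mulrC eq_sym.
have [_ ->] := H; by case: (i == j).
Qed.

(** The primitive in coordinate [j] vanishing where that coordinate is 0, after the substitution
    that moves the integral to the unit interval. *)
Definition antider j F : Cinf := coord j * average j 0 F.

(** The product rule turns the left side into the integral over the unit interval of the derivative
    of [H t = t * F (scale_coord j t p)]. The fundamental theorem evaluates it to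
    [H 1 - H 0 = F p]. *)
Lemma partial_antider j F : partial j (antider j F) = F.
Proof.
apply: CinfP => p.
rewrite partialM partial_coord eqxx mulr1 partial_average eqxx add0n.
transitivity (p 0 j * avg (scaled j 1 (partial j F)) p + avg (scaled j 0 F) p).
  by [].
have c G m : continuous (fun t => scaled j m G (p, t)).
  exact: section_continuous (@scaled_continuous j m G).
have ci G m : mu.-integrable `[0, 1] (EFin \o (fun t => scaled j m G (p, t))).
  exact: integrable01.
pose H t := t * F (scale_coord j t p).
pose h t := p 0 j * scaled j 1 (partial j F) (p, t) + scaled j 0 F (p, t).
have ch : continuous h.
  move=> t; apply: cvgD (c _ _ t); apply: cvgMr; exact: c.
have -> : p 0 j * avg (scaled j 1 (partial j F)) p + avg (scaled j 0 F) p =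
    \int[mu]_(t in `[0, 1]) h t.
  rewrite /avg -RintegralZl// -RintegralD//.
  by apply: integrable01 => t; apply: cvgMr; exact: c.
have dH t : is_derive t 1 H (h t).
  have d1 : is_derive t 1 (fun t => F (scale_coord j t p))
      (partial j F (scale_coord j t p) * p 0 j).
    have -> : (fun t => F (scale_coord j t p)) =
       (fun s => F (scale_coord j 0 p + s *: evec j)) \o ( *%R^~ (p 0 j)).
      by apply/funext => s /=; rewrite scale_coord_origin.
    apply: is_derive1_comp.
      rewrite partialE [scale_coord j t p]scale_coord_origin.
      exact: (@is_derive_line R V F _ _ _ (@Cinf_derivable R n F _ j)).
    have := @is_deriveZ R R R id (p 0 j) t 1 1 (is_derive_id _ _).
    rewrite /GRing.scale /= mulr1; congr is_derive; apply/funext => s /=.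
    by rewrite mulrC.
  have := @is_deriveM R R id (fun t => F (scale_coord j t p)) t 1 _ _
    (is_derive_id _ _) d1.
  rewrite /GRing.scale /= mulr1 /h /scaled /= expr1 expr0 mul1r.
  by congr is_derive; ring.
have cH : continuous H.
  move=> t; apply: differentiable_continuous.
  by apply/derivable1_diffP; have [] := dH t.
rewrite /Rintegral (@continuous_FTC2 R h H 0 1)//.
- by rewrite /= /H mul0r mul1r scale_coord1 subr0.
- exact: continuous_subspaceT.
- split.
  + by move=> t _; have [] := dH t.
  + apply: cvg_at_right_filter; exact: cH.
  + apply: cvg_at_left_filter; exact: cH.
- by move=> t _; rewrite derive1E; have [_ ->] := dH t.
Qed.

Lemma antider_partial i j F : i != j ->
  partial i (antider j F) = antider j (partial i F).
Proof.
move=> ij; rewrite partialM partial_coord (negbTE ij) mulr0 addr0.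
by rewrite partial_average (negbTE ij).
Qed.

Lemma restrB j : zmod_morphism (restr j).
Proof. by move=> F G; apply: CinfP. Qed.
HB.instance Definition _ j :=
  GRing.isZmodMorphism.Build Cinf Cinf (restr j) (@restrB j).

Lemma restr_coord j F : restr j (coord j * F) = 0.
Proof.
apply: CinfP => p.
transitivity (scale_coord j 0 p 0 j * F (scale_coord j 0 p)); first by [].
by rewrite !mxE !eqxx /= mulr1 sub0r mulN1r subrr mul0r.
Qed.

Lemma partial_eq0 j F : partial j F = 0 -> F = restr j F.
Proof.
move=> DF; apply: CinfP => p.
have dF s : is_derive s 1 (fun s => F (scale_coord j 0 p + s *: evec j)) 0.
  have := @is_derive_line R V F (scale_coord j 0 p) (evec j) s
    (@Cinf_derivable R n F _ j).
  by rewrite -partialE DF.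
have /= := is_derive_0_is_cst (p 0 j) 0 dF.
rewrite scale0r addr0 => <-.
by rewrite -[p 0 j]mul1r -scale_coord_origin scale_coord1.
Qed.

(** The difference of [F] and the primitive of its derivative is constant along [j], hence equals
    its own restriction, and the primitive restricts to 0. *)
Lemma Cinf_FTC j F : F = restr j F + antider j (partial j F).
Proof.
apply/eqP; rewrite -subr_eq; apply/eqP.
rewrite [LHS](@partial_eq0 j).
  by rewrite raddfB /= restr_coord subr0.
by rewrite raddfB /= partial_antider subrr.
Qed.

(** For [i != j], [partial i] commutes with restriction and with the primitive in [j]. Apply it to
    the decomposition [Cinf_FTC] of [F], then differentiate in [j]: the restriction drops out. *)
Lemma partialC i j F : partial i (partial j F) = partial j (partial i F).
Proof.
have [->//|ij] := eqVneq i j.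
have -> : partial i F =
    restr j (partial i F) + antider j (partial i (partial j F)).
  by rewrite [in LHS](Cinf_FTC j F) raddfD /= partial_restr (negbTE ij)
    antider_partial.
by rewrite raddfD /= partial_restr eqxx add0r partial_antider.
Qed.

(** Off the hyperplane one divides. On it, the derivative of the product in direction [j] reduces to
    [F] itself. *)
Lemma coord_mul_eq0 j F : coord j * F = 0 -> F = 0.
Proof.
move=> xF; apply: CinfP => p.
have [p0|p0] := eqVneq (p 0 j) 0; last first.
  have : p 0 j * F p = 0 by rewrite -[LHS]/((coord j * F) p) xF.
  by move/eqP; rewrite mulf_eq0 (negbTE p0) => /eqP.
have : partial j (coord j * F) = 0 by rewrite xF raddf0.
rewrite partialM partial_coord eqxx mulr1 => H.
have : p 0 j * partial j F p + F p = 0.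
  by rewrite -[LHS]/((coord j * partial j F + F) p) H.
by rewrite p0 mul0r add0r.
Qed.

End CoordinateScaling.

(** * Multivector calculus in three variables *)

Section ComponentCalculus.
Variables (A : comPzRingType) (Dx Dy Dz : {additive A -> A}).
Hypothesis DxM : forall f g, Dx (f * g) = f * Dx g + g * Dx f.
Hypothesis DyM : forall f g, Dy (f * g) = f * Dy g + g * Dy f.
Hypothesis DzM : forall f g, Dz (f * g) = f * Dz g + g * Dz f.
Hypothesis Dyx : forall f, Dy (Dx f) = Dx (Dy f).
Hypothesis Dzx : forall f, Dz (Dx f) = Dx (Dz f).
Hypothesis Dzy : forall f, Dz (Dy f) = Dy (Dz f).
Variable X : A.
Hypothesis DxX : Dx X = 1.
Hypothesis DyX : Dy X = 0.
Hypothesis DzX : Dz X = 0.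

(* [P a b c] is the coefficient of d_x^a ^ d_y^b ^ d_z^c. The ring is abstract
   to keep the graded identities within reach of [ring]. *)
Local Notation T := (bool -> bool -> bool -> A).
Implicit Types P Q : T.

Definition cwedge P Q : T := fun a b c =>
  match a, b, c with
  | false, false, false => P false false false * Q false false false
  | true, false, false =>
    P false false false * Q true false false +
    P true false false * Q false false false
  | false, true, false =>
    P false false false * Q false true false +
    P false true false * Q false false false
  | false, false, true =>
    P false false false * Q false false true +
    P false false true * Q false false false
  | true, true, false =>
    P false false false * Q true true false +
    P true false false * Q false true false -
    P false true false * Q true false false +
    P true true false * Q false false false
  | true, false, true =>
    P false false false * Q true false true +
    P true false false * Q false false true -
    P false false true * Q true false false +
    P true false true * Q false false false
  | false, true, true =>
    P false false false * Q false true true +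
    P false true false * Q false false true -
    P false false true * Q false true false +
    P false true true * Q false false false
  | true, true, true =>
    P false false false * Q true true true +
    P true false false * Q false true true -
    P false true false * Q true false true +
    P false false true * Q true true false +
    P true true false * Q false false true -
    P true false true * Q false true false +
    P false true true * Q true false false +
    P true true true * Q false false false
  end.

Definition csign (b : bool) (f : A) := if b then - f else f.

(** In the [cl] family the sign counts the odd variables passed when moving the differentiated one
    to the left end, in the [cr] family to the right end. *)
Definition clx P : T := fun a b c => if a then 0 else P true b c.
Definition cly P : T := fun a b c => if b then 0 else csign a (P a true c).
Definition clz P : T :=
  fun a b c => if c then 0 else csign (a (+) b) (P a b true).
Definition crx P : T :=
  fun a b c => if a then 0 else csign (b (+) c) (P true b c).
Definition cry P : T := fun a b c => if b then 0 else csign c (P a true c).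
Definition crz P : T := fun a b c => if c then 0 else P a b true.
Definition cmap (D : A -> A) P : T := fun a b c => D (P a b c).

Definition cschouten P Q : T := fun a b c =>
  (cwedge (crx P) (cmap Dx Q) a b c - cwedge (cmap Dx P) (clx Q) a b c) +
  (cwedge (cry P) (cmap Dy Q) a b c - cwedge (cmap Dy P) (cly Q) a b c) +
  (cwedge (crz P) (cmap Dz Q) a b c - cwedge (cmap Dz P) (clz Q) a b c).

Definition caff : T := fun a b c => if [&& a, b & ~~ c] then X else 0.

Definition cgrade P : T := fun a b c => csign (a (+) b (+) c) (P a b c).

(** The factor d_z is a spectator: the formulas with [c = true] repeat those with [c = false]. The
    components along d_x ^ d_y and d_x ^ d_y ^ d_z never enter on the right. *)
Definition cdiff P : T := fun a b c =>
  match a, b, c with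
  | true, false, false => X * Dy (P false false false)
  | false, true, false => - (X * Dx (P false false false))
  | true, true, false =>
    X * Dx (P true false false) + X * Dy (P false true false) -
    P true false false
  | true, false, true => X * Dy (P false false true)
  | false, true, true => - (X * Dx (P false false true))
  | true, true, true =>
    X * Dx (P true false true) + X * Dy (P false true true) - P true false true
  | _, _, _ => 0
  end.

(** The terms without derivative in [cdiff] come from [Dx X = 1]. *)
Lemma cschouten_caff P a b c : cschouten caff P a b c = cdiff P a b c.
Proof.
by case: a; case: b; case: c;
  rewrite /cschouten /cwedge /cmap /crx /cry /crz /clx /cly /clz /csign /caff /=
    ?raddf0 ?DxX ?DyX ?DzX; ring.
Qed.

Let DxE := (raddfD Dx, raddfN Dx, raddf0 Dx, DxM, DxX).
Let DyE := (raddfD Dy, raddfN Dy, raddf0 Dy, DyM, DyX).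
Let DzE := (raddfD Dz, raddfN Dz, raddf0 Dz, DzM, DzX).

Lemma cdiff_wedge P Q a b c :
  cdiff (cwedge P Q) a b c =
  cwedge (cdiff P) Q a b c + cwedge (cgrade P) (cdiff Q) a b c.
Proof.
case: a; case: b; case: c;
  rewrite /cdiff /cwedge /cgrade /csign /= ?(DxE, DyE); ring.
Qed.

(** Checked component by component: the commutation rules order all second derivatives, after which
    both sides agree as polynomials. *)
Lemma cdiff_schouten P Q a b c :
  cdiff (cschouten P Q) a b c =
  cschouten (cdiff P) Q a b c - cschouten (cgrade P) (cdiff Q) a b c.
Proof.
case: a; case: b; case: c.
all: rewrite /cdiff /cschouten /cwedge /cgrade /cmap
  /crx /cry /crz /clx /cly /clz /csign /=.
all: rewrite ?(DxE, DyE, DzE) ?(Dyx, Dzx, Dzy).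
all: ring.
Qed.

End ComponentCalculus.

(** * Fields without d_x whose coefficients lie in a subring *)

Section TransverseComponents.
Variables (A : comPzRingType) (S : subringClosed A).
Implicit Types F G : bool -> bool -> bool -> A.

(** With the Casimir functions as [S], this is the span of 1, d_y, d_z and d_y ^ d_z in
    components. *)
Definition transverse F :=
  (forall b c, F true b c = 0) /\ (forall a b c, F a b c \in S).

Lemma transverse_wedge F G :
  transverse F -> transverse G -> transverse (cwedge F G).
Proof.
move=> [F0 FS] [G0 GS]; split=> [b c|a b c].
  by case: b; case: c; rewrite /cwedge !F0 !G0; ring.
by case: a; case: b; case: c; rewrite /cwedge;
  do ?[apply: rpredB | apply: rpredD | apply: rpredM].
Qed.

Lemma transverseD F G : transverse F -> transverse G ->
  transverse (fun a b c => F a b c + G a b c).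
Proof.
move=> [F0 FS] [G0 GS]; split=> [b c|a b c]; first by rewrite F0 G0 addr0.
exact: rpredD.
Qed.

Lemma transverseB F G : transverse F -> transverse G ->
  transverse (fun a b c => F a b c - G a b c).
Proof.
move=> [F0 FS] [G0 GS]; split=> [b c|a b c]; first by rewrite F0 G0 subr0.
exact: rpredB.
Qed.

Lemma transverse_cmap (D : {additive A -> A}) F :
  {in S, forall f, D f \in S} -> transverse F -> transverse (cmap D F).
Proof.
move=> DS [F0 FS]; split=> [b c|a b c]; rewrite /cmap; last exact: DS.
by rewrite F0 raddf0.
Qed.

Lemma transverse_odd_deriv F : transverse F ->
  [/\ transverse (clx F), transverse (cly F) & transverse (clz F)] /\
  [/\ transverse (crx F), transverse (cry F) & transverse (crz F)].
Proof.
move=> [F0 FS].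
have signS b f : f \in S -> csign b f \in S.
  by move=> fS; case: b; rewrite /= ?rpredN.
have sign0 b : csign b 0 = 0 :> A by case: b; rewrite /= ?oppr0.
by split; split; split=> [b c|a b c];
  rewrite /clx /cly /clz /crx /cry /crz ?F0 ?sign0 ?if_same ?rpred0//;
  case: ifP => _; rewrite ?rpred0 ?signS ?FS.
Qed.

Variables Dx Dy Dz : {additive A -> A}.
Hypothesis DxS : {in S, forall f, Dx f \in S}.
Hypothesis DyS : {in S, forall f, Dy f \in S}.
Hypothesis DzS : {in S, forall f, Dz f \in S}.

(** The bracket is a sum of wedge products of odd and partial derivatives, each of which preserves
    transversality. *)
Lemma transverse_schouten F G :
  transverse F -> transverse G -> transverse (cschouten Dx Dy Dz F G).
Proof.
move=> tF tG; have [_ [rx ry rz]] := transverse_odd_deriv tF.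
have [[lx ly lz] _] := transverse_odd_deriv tG.
have term (D : {additive A -> A}) U V : {in S, forall f, D f \in S} ->
    transverse U -> transverse V ->
    transverse (fun a b c =>
      cwedge U (cmap D G) a b c - cwedge (cmap D F) V a b c).
  move=> DS tU tV.
  exact: (transverseB (transverse_wedge tU (transverse_cmap DS tG))
    (transverse_wedge (transverse_cmap DS tF) tV)).
have tx := term _ _ _ DxS rx lx; have ty := term _ _ _ DyS ry ly.
have tz := term _ _ _ DzS rz lz.
exact: (transverseD (transverseD tx ty) tz).
Qed.

End TransverseComponents.

(** * Degrees of wedge products and brackets *)

Section GradedDegrees.
Variables (R : realType) (n : nat).
Implicit Types (P Q : mvfield R n) (I J K : {set 'I_n}).

Lemma wedgeDl P P' Q : wedge (P + P') Q = wedge P Q + wedge P' Q.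
Proof.
apply/ffunP => K; rewrite !ffunE -big_split; apply: eq_bigr => I _ /=.
by rewrite ffunE mulrDl mulrDr.
Qed.

Lemma schoutenDl P P' Q : schouten (P + P') Q = schouten P Q + schouten P' Q.
Proof.
rewrite -big_split; apply: eq_bigr => i _ /=.
have -> : odd_deriv_r i (P + P') = odd_deriv_r i P + odd_deriv_r i P'.
  apply/ffunP => K; rewrite !ffunE; case: ifP => _; first by rewrite addr0.
  by rewrite mulrDr.
have -> : mvpartial i (P + P') = mvpartial i P + mvpartial i P'.
  by apply/ffunP => K; rewrite !ffunE raddfD.
by rewrite !wedgeDl opprD addrACA.
Qed.

Lemma wedge_support P Q K :
  (forall I J, (#|I| + #|J|)%N = #|K| -> P I = 0 \/ Q J = 0) -> wedge P Q K = 0.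
Proof.
move=> PQ; rewrite ffunE big1// => I IK.
have cI : (#|I| + #|K :\: I|)%N = #|K|.
  by rewrite -[in RHS](cardsID I) (finset.setIidPr IK).
by have [->|->] := PQ _ _ cI; rewrite ?mulr0 ?mul0r ?mulr0.
Qed.

(** Degree [k - 1] without truncated subtraction: for [k = 0] only the zero field qualifies. This is
    the condition on potentials in [coboundary_pred]. *)
Definition lowered k P := forall I, #|I|.+1 != k -> P I = 0.

Lemma lowered0 P : lowered 0 P -> P = 0.
Proof. by move=> P0; apply/ffunP => I; rewrite ffunE P0. Qed.

Lemma wedge_homogeneous k l P Q :
  homogeneous k P -> homogeneous l Q -> homogeneous (k + l)%N (wedge P Q).
Proof.
move=> hP hQ K nK; apply: wedge_support => I J IJ.
have [kI|/hP] := eqVneq #|I| k; last by left.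
have [lJ|/hQ] := eqVneq #|J| l; last by right.
by rewrite -IJ kI lJ eqxx in nK.
Qed.

Lemma wedge_loweredl k l P Q :
  lowered k P -> homogeneous l Q -> lowered (k + l)%N (wedge P Q).
Proof.
move=> hP hQ K nK; apply: wedge_support => I J IJ.
have [kI|/hP] := eqVneq #|I|.+1 k; last by left.
have [lJ|/hQ] := eqVneq #|J| l; last by right.
by rewrite -IJ -kI -lJ addSn eqxx in nK.
Qed.

Lemma wedge_loweredr k l P Q :
  homogeneous k P -> lowered l Q -> lowered (k + l)%N (wedge P Q).
Proof.
move=> hP hQ K nK; apply: wedge_support => I J IJ.
have [kI|/hP] := eqVneq #|I| k; last by left.
have [lJ|/hQ] := eqVneq #|J|.+1 l; last by right.
by rewrite -IJ -kI -lJ addnS eqxx in nK.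
Qed.

Lemma odd_deriv_r_lowered k i P :
  homogeneous k P -> lowered k (odd_deriv_r i P).
Proof.
move=> hP K nK; rewrite ffunE; case: ifPn => // iK.
by rewrite hP ?mulr0// cardsU1 iK.
Qed.

Lemma odd_deriv_l_lowered k i P :
  homogeneous k P -> lowered k (odd_deriv_l i P).
Proof.
move=> hP K nK; rewrite ffunE; case: ifPn => // iK.
by rewrite hP ?mulr0// cardsU1 iK.
Qed.

Lemma mvpartial_homogeneous k i P :
  homogeneous k P -> homogeneous k (mvpartial i P).
Proof. by move=> hP K nK; rewrite ffunE hP// raddf0. Qed.

(** In every term exactly one factor undergoes an odd derivative, which costs one degree. *)
Lemma schouten_lowered k l P Q :
  homogeneous k P -> homogeneous l Q -> lowered (k + l)%N (schouten P Q).
Proof.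
move=> hP hQ K nK; rewrite sum_ffunE big1// => i _; rewrite !ffunE.
have := wedge_loweredl (odd_deriv_r_lowered i hP) (mvpartial_homogeneous i hQ).
move=> /(_ K nK); rewrite ffunE => ->.
have := wedge_loweredr (mvpartial_homogeneous i hP) (odd_deriv_l_lowered i hQ).
by move=> /(_ K nK); rewrite ffunE => ->; rewrite subr0.
Qed.

(** The truncated predecessor is harmless at [k + l = 0], where the bracket vanishes. *)
Lemma schouten_homogeneous k l P Q :
  homogeneous k P -> homogeneous l Q -> homogeneous (k + l)%N.-1 (schouten P Q).
Proof.
move=> hP hQ K nK; apply: (schouten_lowered hP hQ).
by apply: contra nK => /eqP <-.
Qed.

End GradedDegrees.

(** * From subsets of three indices to boolean components *)

Section ThreeVariables.
Variable R : realType.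
Local Notation mv := (mvfield R 3).
Local Notation Cinf := (Cinf R 3).
Local Notation coord := (@Defs.coord R 3).
Implicit Types P Q : mv.

(** Three membership bits encode a subset of the indices, so that identities over subsets become
    finite case analyses. *)
Definition triset (a b c : bool) : {set 'I_3} :=
  [set i : 'I_3 | nth false [:: a; b; c] i].

Lemma trisetE (I : {set 'I_3}) : I = triset (ix \in I) (iy \in I) (iz \in I).
Proof.
apply/setP => i; rewrite inE; case: i => -[|[|[|//]]] H /=.
- by rewrite (_ : Ordinal H = ix)//; apply/val_inj.
- by rewrite (_ : Ordinal H = iy)//; apply/val_inj.
- by rewrite (_ : Ordinal H = iz)//; apply/val_inj.
Qed.

Lemma mem_triset a b c :
  (ix \in triset a b c = a) * (iy \in triset a b c = b) *
  (iz \in triset a b c = c).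
Proof. by rewrite !inE. Qed.

Lemma mvfieldP P Q :
  (forall a b c, P (triset a b c) = Q (triset a b c)) -> P = Q.
Proof. by move=> PQ; apply/ffunP => I; rewrite (trisetE I). Qed.

Lemma triset_inj a b c a' b' c' :
  (triset a b c == triset a' b' c') = [&& a == a', b == b' & c == c'].
Proof.
apply/eqP/and3P => [E|[/eqP-> /eqP-> /eqP->]//].
split; apply/eqP.
- by have := mem_triset a b c; rewrite E !mem_triset => -[[]].
- by have := mem_triset a b c; rewrite E !mem_triset => -[[]].
- by have := mem_triset a b c; rewrite E !mem_triset => -[[]].
Qed.

Lemma big_triset (V : nmodType) (p : pred {set 'I_3}) (F : {set 'I_3} -> V) :
  \sum_(I | p I) F I =
  \sum_(a : bool) \sum_(b : bool) \sum_(c : bool)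
    (if p (triset a b c) then F (triset a b c) else 0).
Proof.
rewrite big_mkcond !pair_big /=.
rewrite (reindex (fun t : bool * bool * bool => triset t.1.1 t.1.2 t.2)) //=.
exists (fun I : {set 'I_3} => (ix \in I, iy \in I, iz \in I))
  => [[[a b] c] _|I _] /=.
  by rewrite !mem_triset.
by rewrite -trisetE.
Qed.

Lemma triset_sub a b c a' b' c' :
  (triset a b c \subset triset a' b' c') = [&& a ==> a', b ==> b' & c ==> c'].
Proof.
apply/fintype.subsetP/and3P => [S|[/implyP Ha /implyP Hb /implyP Hc] i].
  split; apply/implyP => H.
  - by have := S ix; rewrite !mem_triset; apply.
  - by have := S iy; rewrite !mem_triset; apply.
  - by have := S iz; rewrite !mem_triset; apply.
by rewrite !inE; case: i => -[|[|[|//]]].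
Qed.

Lemma triset_diff a b c a' b' c' :
  triset a b c :\: triset a' b' c' =
  triset (a && ~~ a') (b && ~~ b') (c && ~~ c').
Proof.
by rewrite [LHS]trisetE !finset.in_setD !mem_triset; congr triset; exact: andbC.
Qed.

Lemma card_triset a b c : #|triset a b c| = (a + b + c)%N.
Proof.
by rewrite cardsE -sum1_card big_mkcond !big_ord_recl big_ord0 /= !unfold_in /=;
  case: a; case: b; case: c.
Qed.

(** The three products stand for the out-of-order pairs (y, x), (z, x) and (z, y). *)
Lemma inversions_triset a b c a' b' c' :
  inversions (triset a b c) (triset a' b' c') = (b * a' + c * a' + c * b')%N.
Proof.
rewrite /inversions cardsE -sum1_card big_mkcond.
transitivity (\sum_(i : 'I_3) \sum_(j : 'I_3)
    [&& i \in triset a b c, j \in triset a' b' c' & (j < i)%N])%N.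
  rewrite pair_bigA; apply: eq_bigr => ij _ /=.
  by rewrite unfold_in /=; case: ifP.
rewrite !big_ord_recl !big_ord0 !inE /=.
by case: a; case: b; case: c; case: a'; case: b'; case: c'.
Qed.

Definition mvcoef P a b c : Cinf := P (triset a b c).

Lemma mvcoef_wedge P Q a b c :
  mvcoef (wedge P Q) a b c = cwedge (mvcoef P) (mvcoef Q) a b c.
Proof.
rewrite /mvcoef ffunE big_triset !big_bool.
rewrite !triset_sub !triset_diff !inversions_triset.
(* Only the parity of the inversions matters, and it is a boolean expression in the membership
   bits. *)
rewrite -!(signr_odd _ (_ + _)%N) !mulr_sign !oddD !oddM !oddb.
by case: a; case: b; case: c => /=; rewrite ?addr0 ?add0r; ring.
Qed.

Lemma triset1 : ([set ix] = triset true false false) *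
  ([set iy] = triset false true false) * ([set iz] = triset false false true).
Proof. by split; [split|]; rewrite [LHS]trisetE !inE. Qed.

Lemma triset_union a b c a' b' c' :
  triset a b c :|: triset a' b' c' = triset (a || a') (b || b') (c || c').
Proof. by rewrite [LHS]trisetE !finset.in_setU !mem_triset. Qed.

Lemma mvcoef_odd_deriv_l P :
  (mvcoef (odd_deriv_l ix P) = clx (mvcoef P)) *
  (mvcoef (odd_deriv_l iy P) = cly (mvcoef P)) *
  (mvcoef (odd_deriv_l iz P) = clz (mvcoef P)).
Proof.
by split; [split|]; apply/funext => a; apply/funext => b; apply/funext => c;
  rewrite /mvcoef ffunE mem_triset !triset1 triset_union inversions_triset
    -(signr_odd _ (_ + _)%N) mulr_sign !oddD !oddM !oddb;
  case: a; case: b; case: c.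
Qed.

Lemma mvcoef_odd_deriv_r P :
  (mvcoef (odd_deriv_r ix P) = crx (mvcoef P)) *
  (mvcoef (odd_deriv_r iy P) = cry (mvcoef P)) *
  (mvcoef (odd_deriv_r iz P) = crz (mvcoef P)).
Proof.
by split; [split|]; apply/funext => a; apply/funext => b; apply/funext => c;
  rewrite /mvcoef ffunE mem_triset !triset1 triset_union inversions_triset
    -(signr_odd _ (_ + _)%N) mulr_sign !oddD !oddM !oddb;
  case: a; case: b; case: c.
Qed.

Lemma mvcoef_mvpartial i P :
  mvcoef (mvpartial i P) = cmap (partial i) (mvcoef P).
Proof.
by do 3![apply/funext => ?]; rewrite /mvcoef ffunE.
Qed.

Lemma mvcoefB P Q a b c :
  mvcoef (P - Q) a b c = mvcoef P a b c - mvcoef Q a b c.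
Proof. by rewrite /mvcoef !ffunE. Qed.

Lemma mvcoef_schouten P Q a b c :
  mvcoef (schouten P Q) a b c =
  cschouten (partial ix) (partial iy) (partial iz) (mvcoef P) (mvcoef Q) a b c.
Proof.
have term i : (wedge (odd_deriv_r i P) (mvpartial i Q) -
     wedge (mvpartial i P) (odd_deriv_l i Q)) (triset a b c) =
   cwedge (mvcoef (odd_deriv_r i P)) (cmap (partial i) (mvcoef Q)) a b c -
   cwedge (cmap (partial i) (mvcoef P)) (mvcoef (odd_deriv_l i Q)) a b c.
  by rewrite -[LHS]/(mvcoef _ a b c) mvcoefB !mvcoef_wedge !mvcoef_mvpartial.
rewrite /mvcoef sum_ffunE !big_ord_recl big_ord0 addr0 !term addrA.
rewrite (_ : ord0 = ix); last exact/val_inj.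
rewrite (_ : lift ix (lift ord0 ord0) = iz); last exact/val_inj.
rewrite (_ : lift ix ord0 = iy); last exact/val_inj.
by rewrite !mvcoef_odd_deriv_l !mvcoef_odd_deriv_r.
Qed.

Lemma mvcoef_aff_poisson a b c :
  mvcoef (aff_poisson R) a b c = caff (coord ix) a b c.
Proof.
rewrite /mvcoef mvfieldZE.
have -> : wedge (vfield R ix) (vfield R iy) (triset a b c) =
    cwedge (mvcoef (vfield R ix)) (mvcoef (vfield R iy)) a b c.
  exact: mvcoef_wedge.
have v i a' b' c' :
    mvcoef (vfield R i) a' b' c' = (triset a' b' c' == [set i])%:R.
  by rewrite /mvcoef ffunE.
rewrite /cwedge !v !triset1 !triset_inj.
by case: a; case: b; case: c; rewrite /caff /=; ring.
Qed.

End ThreeVariables.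

(** * The differential of the affine Poisson structure *)

Section AffinePoisson.
Variable R : realType.
Local Notation mv := (mvfield R 3).
Local Notation Cinf := (Cinf R 3).
Local Notation coord := (@Defs.coord R 3).
Local Notation x := (coord ix).
Local Notation Dx := (partial ix).
Local Notation Dy := (partial iy).
Local Notation Dz := (partial iz).
Local Notation pi := (aff_poisson R).
Local Notation d := (schouten pi).
Implicit Types (P Q : mv) (f g : Cinf).

Let xE : (Dx x = 1) * (Dy x = 0) * (Dz x = 0).
Proof. by rewrite !partial_coord. Qed.

Lemma mvcoef_differential Q : mvcoef (d Q) = cdiff Dx Dy x (mvcoef Q).
Proof.
do 3![apply/funext => ?]; rewrite mvcoef_schouten.
have -> : mvcoef pi = caff x.
  by do 3![apply/funext => ?]; exact: mvcoef_aff_poisson.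
by apply: cschouten_caff; rewrite /= xE.
Qed.

(** Making the sign an operator states the graded Leibniz rules for fields of mixed degree. *)
Definition graded_sign P : mv := [ffun I : {set 'I_3} => (-1) ^+ #|I| * P I].

Lemma mvcoef_graded_sign P : mvcoef (graded_sign P) = cgrade (mvcoef P).
Proof.
apply/funext => a; apply/funext => b; apply/funext => c.
by rewrite /mvcoef ffunE card_triset -signr_odd mulr_sign !oddD !oddb.
Qed.

Lemma graded_sign_homogeneous k P :
  homogeneous k P -> graded_sign P = (-1) ^+ k *: P.
Proof.
move=> hP; apply/ffunP => I; rewrite ffunE mvfieldZE.
by have [->//|/hP ->] := eqVneq #|I| k; rewrite !mulr0.
Qed.

Lemma mvcoefD P Q a b c :
  mvcoef (P + Q) a b c = mvcoef P a b c + mvcoef Q a b c.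
Proof. by rewrite /mvcoef !ffunE. Qed.

Lemma mvcoef_inj P Q : mvcoef P = mvcoef Q -> P = Q.
Proof.
by move=> PQ; apply: mvfieldP => a b c; rewrite -[LHS]/(mvcoef P a b c) PQ.
Qed.

Lemma mvcoef_wedge_fun P Q : mvcoef (wedge P Q) = cwedge (mvcoef P) (mvcoef Q).
Proof. by do 3![apply/funext => ?]; exact: mvcoef_wedge. Qed.

Lemma mvcoef_schouten_fun P Q :
  mvcoef (schouten P Q) = cschouten Dx Dy Dz (mvcoef P) (mvcoef Q).
Proof. by do 3![apply/funext => ?]; exact: mvcoef_schouten. Qed.

Lemma differential_wedge P Q :
  d (wedge P Q) = wedge (d P) Q + wedge (graded_sign P) (d Q).
Proof.
apply: mvcoef_inj; do 3![apply/funext => ?].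
rewrite mvcoefD !(mvcoef_wedge_fun, mvcoef_differential, mvcoef_graded_sign).
by apply: cdiff_wedge; exact: partialM.
Qed.

Lemma differential_schouten P Q :
  d (schouten P Q) = schouten (d P) Q - schouten (graded_sign P) (d Q).
Proof.
(* Over variables, as unification would unfold brackets to compare them. *)
have aux dP dQ sP S dS U V :
    mvcoef dP = cdiff Dx Dy x (mvcoef P) ->
    mvcoef dQ = cdiff Dx Dy x (mvcoef Q) ->
    mvcoef dS = cdiff Dx Dy x (mvcoef S) ->
    mvcoef sP = cgrade (mvcoef P) ->
    mvcoef S = cschouten Dx Dy Dz (mvcoef P) (mvcoef Q) ->
    mvcoef U = cschouten Dx Dy Dz (mvcoef dP) (mvcoef Q) ->
    mvcoef V = cschouten Dx Dy Dz (mvcoef sP) (mvcoef dQ) ->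
    dS = U - V.
  move=> EdP EdQ EdS EsP ES EU EV; apply: mvcoef_inj; do 3![apply/funext => ?].
  rewrite mvcoefB EdS ES EU EV EdP EdQ EsP.
  have [[xx xy] xz] := xE.
  by apply: cdiff_schouten => //;
    first [exact: partialM|move=> f; exact: partialC].
exact: (aux _ _ _ _ _ _ _ (mvcoef_differential P) (mvcoef_differential Q)
  (mvcoef_differential _) (mvcoef_graded_sign P) (mvcoef_schouten_fun P Q)
  (mvcoef_schouten_fun _ _) (mvcoef_schouten_fun _ _)).
Qed.

(** The only nonzero component of [pi] is along d_x ^ d_y, on which [cdiff] does not depend. *)
Lemma aff_poisson_poisson : poisson pi.
Proof.
split=> [I|].
  rewrite (trisetE I) card_triset => nI.
  rewrite -[LHS]/(mvcoef pi _ _ _) mvcoef_aff_poisson /caff.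
  by move: nI; case: (ix \in I); case: (iy \in I); case: (iz \in I).
apply: mvcoef_inj; rewrite mvcoef_differential.
have -> : mvcoef pi = caff x.
  by do 3![apply/funext => ?]; exact: mvcoef_aff_poisson.
apply/funext => a; apply/funext => b; apply/funext => c.
have -> : mvcoef (0 : mv) a b c = 0 by rewrite /mvcoef ffunE.
by case: a; case: b; case: c; rewrite /cdiff /caff /= ?raddf0 ?xE; ring.
Qed.

End AffinePoisson.

(** * Casimir functions and cohomology *)

Section Potentials.
Variables (R : realType) (n : nat).
Local Notation Cinf := (Cinf R n).
Local Notation coord := (@Defs.coord R n).
Implicit Types (F G : Cinf) (i j : 'I_n).

(** Characterizes the primitive by its derivative and its vanishing on the hyperplane; the
    identities for [antider] below are proved this way. *)
Lemma antiderP j F G : partial j G = F -> restr j G = 0 -> G = antider j F.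
Proof. by move=> <- G0; rewrite {1}(Cinf_FTC j G) G0 add0r. Qed.

Lemma antider0 j : antider j (0 : Cinf) = 0.
Proof. by rewrite -(antiderP (raddf0 _) (raddf0 _)). Qed.

Lemma antider_coordM i j F :
  i != j -> antider i (coord j * F) = coord j * antider i F.
Proof.
move=> ij; apply/esym/antiderP.
  by rewrite partialM partial_antider partial_coord (negbTE ij) mulr0 addr0.
by rewrite /antider mulrCA restr_coord.
Qed.

Lemma restr_idem j F : restr j (restr j F) = restr j F.
Proof.
by apply/esym/partial_eq0; rewrite partial_restr eqxx.
Qed.

(** Hadamard's lemma, with the mean value of the partial derivative as quotient. *)
Lemma Hadamard_quotient j F : exists G, F = restr j F + coord j * G.
Proof. by exists (average j 0 (partial j F)); exact: Cinf_FTC. Qed.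

(* The cocycle equation for two of the components, in degrees 1 and 2 alike;
   [r] is the cohomology class. *)
Lemma potential i j (a b : Cinf) : i != j ->
  coord i * partial i a + coord i * partial j b - a = 0 ->
  exists f r, [/\ a = coord i * partial j f, b = r - coord i * partial i f,
    partial i r = 0 & partial j r = 0].
Proof.
move=> ij ab; have ji : j != i by rewrite eq_sym.
pose u := partial i a + partial j b.
have aE : a = coord i * u by apply/eqP; rewrite eq_sym -subr_eq0 mulrDr ab.
(* Differentiate [a = coord i * u] in direction [i] and compare with the definition of [u]. *)
have ub : partial j b = - (coord i * partial i u).
  have Da : partial i a = coord i * partial i u + u.
    by rewrite [in LHS]aE partialM partial_coord eqxx mulr1.
  by rewrite -(addKr (partial i a) (partial j b)) -/u [in LHS]Da opprD addrNK.
(* The primitive of [u] alone recovers [b] only up to [restr j b]; [v] corrects this up to the value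
   where both coordinates vanish. *)
have [v vE] := Hadamard_quotient i (restr j b).
have jv : partial j v = 0.
  apply: (@coord_mul_eq0 R n i).
  have := congr1 (partial j) vE.
  rewrite raddfD /= partialM partial_coord (negbTE ji) mulr0 addr0.
  by rewrite !partial_restr eqxx (negbTE ji) raddf0 add0r.
(* By [ub], both sides are primitives in [j] of [- partial j b] that vanish where coordinate [j]
   does. *)
have xu : coord i * antider j (partial i u) = restr j b - b.
  rewrite -antider_coordM 1?eq_sym//; apply/esym/antiderP.
    by rewrite raddfB /= partial_restr eqxx sub0r ub opprK.
  by rewrite raddfB /= restr_idem subrr.
(* Since [v] is constant along [j], the second term leaves [partial j f = u] intact, while
   [partial i] of it contributes [- v]. *)
exists (antider j u - antider i v), (restr i (restr j b)); split.
- by rewrite raddfB /= partial_antider antider_partial// jv antider0 subr0.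
- rewrite raddfB /= antider_partial// partial_antider mulrBr xu.
  have -> : coord i * v = restr j b - restr i (restr j b).
    by apply/eqP; rewrite eq_sym subr_eq addrC -vE.
  by ring.
- by rewrite partial_restr eqxx.
- by rewrite partial_restr (negbTE ji) partial_restr eqxx raddf0.
Qed.

End Potentials.

(** * Casimir functions as smooth functions of z *)

Section CasimirFunctions.
Variable R : realType.
Local Notation mv := (mvfield R 3).
Local Notation Cinf := (Cinf R 3).
Local Notation coord := (@Defs.coord R 3).
Local Notation x := (coord ix).
Local Notation Dx := (partial ix).
Local Notation Dy := (partial iy).
Local Notation Dz := (partial iz).
Local Notation pi := (aff_poisson R).
Implicit Types (P Q : mv) (f g : Cinf).

Lemma mvcoefZ f P a b c : mvcoef (f *: P) a b c = f * mvcoef P a b c.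
Proof. by rewrite /mvcoef mvfieldZE. Qed.

Lemma mvcoef_basis a b c a' b' c' :
  mvcoef (mvbasis R (triset a b c)) a' b' c' =
  [&& a' == a, b' == b & c' == c]%:R.
Proof. by rewrite /mvcoef ffunE triset_inj. Qed.

Lemma triset0 : finset.set0 = triset false false false.
Proof. by rewrite [LHS]trisetE !inE. Qed.

Lemma mvcoef0 a b c : mvcoef (0 : mv) a b c = 0.
Proof. by rewrite /mvcoef ffunE. Qed.

Lemma mvcoef_eq0 P a b c : P = 0 -> mvcoef P a b c = 0.
Proof. by move=> ->; exact: mvcoef0. Qed.

(** The differential of [f] has components [x * Dy f] and [- (x * Dx f)], and the factor [x] cancels
    by [coord_mul_eq0]. *)
Lemma casimirE f : (f \in casimir_pred pi) <-> (Dx f = 0 /\ Dy f = 0).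
Proof.
have E P : P = f *: mvbasis R (triset false false false) ->
    mvcoef P = fun a b c => f * [&& ~~ a, ~~ b & ~~ c]%:R.
  move=> ->; do 3![apply/funext => ?]; rewrite mvcoefZ mvcoef_basis.
  by rewrite !eqbF_neg.
rewrite /casimir_pred unfold_in triset0.
move: E; move: (f *: _) => Q /(_ Q erefl) E.
have dE := mvcoef_differential Q.
split=> [/eqP dQ|[fx fy]].
  split; apply: (@coord_mul_eq0 R 3 ix).
    have := mvcoef_eq0 false true false dQ.
    by rewrite dE /cdiff E /= mulr1 => /eqP; rewrite oppr_eq0 => /eqP.
  have := mvcoef_eq0 true false false dQ.
  by rewrite dE /cdiff E /= mulr1.
apply/eqP/mvcoef_inj; rewrite dE E.
by do 3![apply/funext => -[]]; rewrite mvcoef0 /cdiff //= ?mulr1 ?mulr0 ?raddf0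
  ?fx ?fy ?mulr0 ?oppr0 ?addr0 ?subr0 ?oppr0.
Qed.

Lemma smooth1_continuous (g : R -> R) : smooth1 g -> continuous g.
Proof.
move=> sg t; apply: differentiable_continuous.
by apply/derivable1_diffP; exact: (sg 0%N t).
Qed.

Lemma smooth1_derive (g : R -> R) : smooth1 g -> smooth1 (derive1 g).
Proof. by move=> sg k t; have := sg k.+1 t; rewrite derive1Sn. Qed.

Lemma is_derive_coord_comp (n : nat) (i j : 'I_n) (g : R -> R) (p : 'rV[R]_n) :
  smooth1 g ->
  is_derive p (evec R i) (fun p => g (p 0 j)) ((i == j)%:R * derive1 g (p 0 j)).
Proof.
move=> sg; apply: is_derive_line0.
have -> : (fun s : R => g ((p + s *: evec R i) 0 j)) =
    g \o (fun s => p 0 j + s * (i == j)%:R).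
  by apply/funext => s /=; rewrite !mxE eqxx eq_sym.
rewrite mulrC; apply: is_derive1_comp.
  by rewrite mul0r addr0 derive1E; apply: derivableP; exact: (sg 0%N).
have := @is_deriveD R R R (cst (p 0 j)) _ 0 1 _ _ (is_derive_cst _ _ _)
 (@is_deriveZ R R R id ((i == j)%:R) 0 1 1 (is_derive_id _ _)).
rewrite add0r /GRing.scale /= mulr1; congr is_derive; apply/funext => s /=.
by rewrite mulrC.
Qed.

Lemma smooth_coord_comp (n : nat) (j : 'I_n) (g : R -> R) :
  smooth1 g -> (fun p : 'rV[R]_n => g (p 0 j)) \in @smooth_pred R n.
Proof.
move=> sg; apply/asboolP => k; elim: k g sg => [|k IH] g sg;
  have cg : continuous (fun p : 'rV[R]_n => g (p 0 j)).
- move=> p; apply: continuous_comp; first exact: coord_continuous.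
  exact: smooth1_continuous.
- by split.
- move=> p; apply: continuous_comp; first exact: coord_continuous.
  exact: smooth1_continuous.
split=> // i; split=> [p|].
  by have [] := is_derive_coord_comp i j p sg.
have -> : 'D_(evec R i) (fun p : 'rV[R]_n => g (p 0 j)) =
    cst (i == j)%:R * (fun p => derive1 g (p 0 j)).
  by apply/funext => p; have [_ ->] := is_derive_coord_comp i j p sg.
by apply: CkM; [exact: Ck_cst|apply: IH; exact: smooth1_derive].
Qed.

Lemma scale_coord_xy (p : 'rV[R]_3) :
  scale_coord iy 0 (scale_coord ix 0 p) = p 0 iz *: evec R iz.
Proof.
apply/rowP => i; rewrite /scale_coord !mxE /=.
case: i => -[|[|[|//]]] H; rewrite -!val_eqE /=.
- rewrite (_ : Ordinal H = ix); [ring|exact/val_inj].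
- rewrite (_ : Ordinal H = iy); [ring|exact/val_inj].
- rewrite (_ : Ordinal H = iz); [ring|exact/val_inj].
Qed.

(** A function with vanishing x and y derivatives equals its restriction to the z-axis, which
    provides [g]. *)
Lemma casimir_functions (F : 'rV[R]_3 -> R) :
  (exists f : casimir pi, F = f) <->
  (exists2 g : R -> R, smooth1 g & F = (fun p => g (p 0 iz))).
Proof.
split=> [[[f cf] ->]|[g sg ->]].
  have [fx fy] := (casimirE f).1 cf.
  (* The derivatives of [g] are the iterated z-derivatives of [f] along the axis, hence derivable to
     all orders. *)
  have it k : derive1n k (fun t : R => f (0 + t *: evec R iz)) =
      fun t : R => iter k Dz f (0 + t *: evec R iz).
    elim: k => // k IH; rewrite /= IH; apply/funext => t.
    rewrite derive1E partialE.
    by have [_ ->] := @is_derive_line R _ (iter k Dz f) 0 (evec R iz) t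
      (@Cinf_derivable R 3 _ _ _).
  exists (fun t => f (0 + t *: evec R iz)) => [k t|].
    rewrite it.
    by have [] := @is_derive_line R _ (iter k Dz f) 0 (evec R iz) t
      (@Cinf_derivable R 3 _ _ _).
  apply/funext => p; rewrite add0r -scale_coord_xy /=.
  rewrite [in LHS](partial_eq0 fx) -[LHS]/(f (scale_coord ix 0 p)).
  by rewrite [in LHS](partial_eq0 fy).
pose f := MkCinf (smooth_coord_comp iz sg).
have Df i : i != iz -> partial i f = 0.
  move=> iz0; apply: CinfP => p; rewrite partialE.
  by have [_ ->] := is_derive_coord_comp i iz p sg; rewrite (negbTE iz0) mul0r.
have cf : f \in casimir_pred pi by apply/casimirE; rewrite !Df.
by exists (MkCasimir cf).
Qed.

End CasimirFunctions.

(** * The span of the representatives *)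

Section CasimirSpan.
Variable R : realType.
Local Notation mv := (mvfield R 3).
Local Notation Cinf := (Cinf R 3).
Local Notation Dx := (partial ix).
Local Notation Dy := (partial iy).
Local Notation Dz := (partial iz).
Local Notation pi := (aff_poisson R).
Local Notation cas := (casimir_pred pi).
Implicit Types (P Q : mv) (f g : Cinf) (F G : bool -> bool -> bool -> Cinf).

Lemma partial_casimir i f : f \in cas -> partial i f \in cas.
Proof.
move=> /casimirE[fx fy]; apply/casimirE.
by rewrite ![partial _ (partial i f)]partialC fx fy raddf0.
Qed.

Lemma wedge_dy_dz :
  wedge (vfield R iy) (vfield R iz) = mvbasis R (triset false true true).
Proof.
apply: mvcoef_inj; rewrite mvcoef_wedge_fun /vfield !triset1.
do 3![apply/funext => -[]]; rewrite /cwedge !mvcoef_basis /=; ring.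
Qed.

(** Reduces closure of the span under both operations to the componentwise lemmas on
    [transverse]. *)
Lemma casimir_spanE P :
  casimir_span pi [:: mvbasis R finset.set0; vfield R iy; vfield R iz;
    wedge (vfield R iy) (vfield R iz)] P <->
  transverse cas (mvcoef P).
Proof.
rewrite wedge_dy_dz triset0 /vfield !triset1.
have basisE (c0 c1 c2 c3 : Cinf) a b c :
  mvcoef (c0 *: mvbasis R (triset false false false) +
    (c1 *: mvbasis R (triset false true false) +
    (c2 *: mvbasis R (triset false false true) +
     c3 *: mvbasis R (triset false true true)))) a b c =
  if a then 0 else if b then if c then c3 else c1 else if c then c2 else c0.
  rewrite !mvcoefD !mvcoefZ !mvcoef_basis.
  by case: a; case: b; case: c; rewrite /=; ring.
split=> [[k ->]|[P0 Pc]].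
  rewrite !big_ord_recl big_ord0 addr0 /=.
  split=> [b c|a b c]; rewrite basisE//.
  by case: a; case: b; case: c; rewrite ?casimirP ?rpred0.
pose k := [:: MkCasimir (Pc false false false); MkCasimir (Pc false true false);
  MkCasimir (Pc false false true); MkCasimir (Pc false true true)].
exists (fun i : 'I_4 => k`_i).
rewrite !big_ord_recl big_ord0 addr0 /=.
apply: mvcoef_inj; do 3![apply/funext => -[]]; rewrite basisE /= ?P0.
all: by [].
Qed.

End CasimirSpan.

(** * Bases and induced operations on quotients *)

Section CohomologyModule.
Variables (R : realType) (n : nat) (pi : mvfield R n).
Local Notation mv := (mvfield R n).
Local Notation cocycle := (cocycle pi).

Lemma cocycle_homogeneous k (P : cocycle k) : homogeneous k (cocycle_field P).
Proof. by have /asboolP[] := cocycleP P. Qed.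

Lemma cocycle_closed k (P : cocycle k) : schouten pi (cocycle_field P) = 0.
Proof. by have /asboolP[] := cocycleP P. Qed.

Lemma coboundaryP k (P : cocycle k) :
  P \in @coboundary_pred R n pi k <->
  exists2 A : mv, lowered k A & cocycle_field P = schouten pi A.
Proof. by split=> [/asboolP//|H]; apply/asboolP. Qed.

Lemma cohom_class_eq k (P Q : cocycle k) :
  cohom_class P = cohom_class Q <-> P - Q \in @coboundary_pred R n pi k.
Proof. exact: proj_quotmodE. Qed.

Lemma cohom_class_sum k m (c : 'I_m -> casimir pi) (e : 'I_m -> cocycle k) :
  \sum_i c i *: cohom_class (e i) = cohom_class (\sum_i c i *: e i).
Proof.
have cD := @proj_quotmodD _ _ (@coboundary_pred R n pi k).
apply: (big_ind2
    (fun (u : cohomology pi k) (v : cocycle k) => u = cohom_class v))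
  => [|u v u' v' -> ->|i _].
- apply/esym/(addrI (cohom_class (0 : cocycle k))).
  by rewrite addr0 -[LHS](cD 0 0) addr0.
- exact/esym/cD.
- exact: (@scale_proj_quotmod _ _ (@coboundary_pred R n pi k)).
Qed.

Lemma cocycle_field_sum k m (c : 'I_m -> casimir pi) (e : 'I_m -> cocycle k) :
  cocycle_field (\sum_i c i *: e i) =
  \sum_i (c i : Cinf R n) *: (cocycle_field (e i) : mv).
Proof.
by rewrite (big_morph (@cocycle_field _ _ _ k) (id1 := 0) (op1 := +%R)).
Qed.

(** Moves the basis property from classes to cocycles modulo coboundaries; uniqueness is freeness
    applied to the difference of two coefficient families. *)
Lemma cohomology_basis k m (b : m.-tuple (cohomology pi k))
    (e : 'I_m -> cocycle k) :
  (forall i, tnth b i = cohom_class (e i)) ->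
  (forall P : cocycle k, exists c : 'I_m -> casimir pi,
     P - \sum_i c i *: e i \in @coboundary_pred R n pi k) ->
  (forall c : 'I_m -> casimir pi,
     \sum_i c i *: e i \in @coboundary_pred R n pi k -> forall i, c i = 0) ->
  is_basis b.
Proof.
move=> be gen free v; have [P ->] := proj_quotmod_surj v.
have sumE (c : {ffun 'I_m -> casimir pi}) :
    \sum_i c i *: tnth b i = cohom_class (\sum_i c i *: e i).
  by rewrite -cohom_class_sum; apply: eq_bigr => i _; rewrite be.
have [c cP] := gen P; exists [ffun i => c i]; split.
  rewrite sumE; apply/cohom_class_eq.
  by under eq_bigr do rewrite ffunE.
move=> c' Pc'; apply/ffunP => i; rewrite ffunE; apply/eqP; rewrite -subr_eq0.
apply/eqP; apply: (free (fun i => c i - c' i)).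
under eq_bigr do rewrite scalerBl.
rewrite sumrB; apply/cohom_class_eq.
transitivity (cohom_class P); last by rewrite -sumE.
by apply/esym/cohom_class_eq.
Qed.

(** The induced operation uses chosen representatives [P'] and [Q']. Independence of the choice
    follows from [op P Q - op P' Q' = op (P - P') Q + op P' (Q - Q')], where both terms are
    exact. *)
Lemma descendsP (op : mv -> mv -> mv) (deg : nat -> nat -> nat) :
  (forall P P' Q, op (P + P') Q = op P Q + op P' Q) ->
  (forall P Q Q', op P (Q + Q') = op P Q + op P Q') ->
  (forall k l (P : cocycle k) (Q : cocycle l),
     op (cocycle_field P) (cocycle_field Q) \in cocycle_pred pi (deg k l)) ->
  (forall k l (A : mv) (Q : cocycle l), lowered k A ->
     exists2 B, lowered (deg k l) B &
       op (schouten pi A) (cocycle_field Q) = schouten pi B) ->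
  (forall k l (P : cocycle k) (A : mv), lowered l A ->
     exists2 B, lowered (deg k l) B &
       op (cocycle_field P) (schouten pi A) = schouten pi B) ->
  descends pi op deg.
Proof.
move=> opDl opDr op_cocycle op_exactl op_exactr k l.
pose opc (P : cocycle k) (Q : cocycle l) := MkCocycle (op_cocycle k l P Q).
exists (fun u v => cohom_class
  (opc (sval (proj_quotmod_surj u)) (sval (proj_quotmod_surj v)))).
move=> P Q; exists (opc P Q) => //.
case: proj_quotmod_surj => P' /= /cohom_class_eq/coboundaryP[A lA PA].
case: proj_quotmod_surj => Q' /= /cohom_class_eq/coboundaryP[B lB QB].
have [A' lA' EA] := op_exactl _ _ _ Q lA.
have [B' lB' EB] := op_exactr _ _ P' _ lB.
apply/esym/cohom_class_eq/coboundaryP; exists (A' + B').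
  by move=> I nI; rewrite ffunE lA' ?lB' ?addr0.
rewrite raddfD /= -EA -EB -PA -QB.
have subE k' (U V : cocycle k') :
  cocycle_field U = cocycle_field (U - V) + cocycle_field V :> mv.
  by rewrite -[LHS]/(cocycle_field U : mv) -{1}(subrK V U).
rewrite -[LHS]/((op (cocycle_field P) (cocycle_field Q) : mv) -
  op (cocycle_field P') (cocycle_field Q')).
rewrite [X in op X _ - _](subE _ P P') opDl.
rewrite [X in _ + op _ X - _](subE _ Q Q') opDr.
by rewrite !addrA addrK.
Qed.

End CohomologyModule.

(** * Wedge product and bracket on cohomology *)

Section AffineOperations.
Variable R : realType.
Local Notation mv := (mvfield R 3).
Local Notation pi := (aff_poisson R).
Local Notation d := (schouten pi).
Implicit Types P Q A : mv.

Lemma wedge0l Q : wedge (0 : mv) Q = 0.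
Proof. by apply: (addIr (wedge 0 Q)); rewrite -wedgeDl !add0r. Qed.

Lemma schouten0l Q : schouten (0 : mv) Q = 0.
Proof. by apply: (addIr (schouten 0 Q)); rewrite -schoutenDl !add0r. Qed.

Lemma wedgeNl P Q : wedge (- P) Q = - wedge P Q.
Proof. by apply/eqP; rewrite -addr_eq0 -wedgeDl addNr wedge0l. Qed.

Lemma schoutenNl P Q : schouten (- P) Q = - schouten P Q.
Proof. by apply/eqP; rewrite -addr_eq0 -schoutenDl addNr schouten0l. Qed.

Lemma graded_sign_odd k P :
  homogeneous k P -> graded_sign P = if odd k then - P else P.
Proof.
move=> /graded_sign_homogeneous ->; rewrite -signr_odd.
by case: (odd k); rewrite ?scaleN1r ?scale1r.
Qed.

Lemma cocycle_wedge k l (P : cocycle pi k) (Q : cocycle pi l) :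
  wedge (cocycle_field P) (cocycle_field Q) \in cocycle_pred pi (k + l).
Proof.
apply/asboolP; split.
  by apply: wedge_homogeneous; exact: cocycle_homogeneous.
rewrite (differential_wedge (cocycle_field P)).
by rewrite (cocycle_closed P) (cocycle_closed Q) wedge0l raddf0 addr0.
Qed.

Lemma cocycle_schouten k l (P : cocycle pi k) (Q : cocycle pi l) :
  schouten (cocycle_field P) (cocycle_field Q) \in cocycle_pred pi (k + l)%N.-1.
Proof.
apply/asboolP; split.
  by apply: schouten_homogeneous; exact: cocycle_homogeneous.
rewrite (differential_schouten (cocycle_field P)).
by rewrite (cocycle_closed P) (cocycle_closed Q) schouten0l raddf0 subr0.
Qed.

Lemma lowered_opp k A : lowered k A -> lowered k (- A).
Proof. by move=> lA I nI; rewrite ffunE lA// oppr0. Qed.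

Lemma lowered_zero k : lowered k (0 : mv).
Proof. by move=> I _; rewrite ffunE. Qed.

Lemma descends_wedge : descends pi (@wedge R 3) addn.
Proof.
apply: descendsP; [exact: wedgeDl|by move=> *; exact: raddfD|
  exact: cocycle_wedge|move=> k l A Q lA|move=> k l P A lA].
  exists (wedge A (cocycle_field Q)).
    by apply: wedge_loweredl => //; exact: cocycle_homogeneous.
  by rewrite (differential_wedge A) (cocycle_closed Q) raddf0 addr0.
have hP := @cocycle_homogeneous _ _ _ _ P.
have dE := differential_wedge (cocycle_field P) A.
rewrite (cocycle_closed P) wedge0l add0r (graded_sign_odd hP) in dE.
have lB := wedge_loweredr hP lA.
(* For closed [P] of degree [k], the graded rule gives d(P ^ A) = (-1)^k P ^ dA; the witness absorbs
   this sign. *)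
exists (if odd k then - wedge (cocycle_field P) A
        else wedge (cocycle_field P) A).
  by case: odd => //; exact: lowered_opp.
case: (odd k) dE => dE; last exact: esym.
by apply: (etrans _ (esym (raddfN d _))); rewrite /= dE wedgeNl opprK.
Qed.

Lemma descends_schouten :
  descends pi (@schouten R 3) (fun k l => (k + l)%N.-1).
Proof.
apply: descendsP; [exact: schoutenDl|by move=> *; exact: raddfD|
  exact: cocycle_schouten|move=> k l A Q lA|move=> k l P A lA].
  (* An exact field of degree 0 is zero. Otherwise the predecessor of the total degree is genuine,
     and [lowered k.+1] is [homogeneous k] by computation. *)
  case: k lA => [/lowered0 ->|k lA].
    exists 0; first exact: lowered_zero.
    by rewrite raddf0 schouten0l.
  exists (schouten A (cocycle_field Q)).
    by apply: schouten_lowered => //; exact: cocycle_homogeneous.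
  by rewrite (differential_schouten A) (cocycle_closed Q) raddf0 subr0.
case: l lA => [/lowered0 ->|l lA].
  exists 0; first exact: lowered_zero.
  by rewrite !raddf0.
have hP := @cocycle_homogeneous _ _ _ _ P.
have dE := differential_schouten (cocycle_field P) A.
rewrite (cocycle_closed P) schouten0l add0r (graded_sign_odd hP) in dE.
have lB : lowered (k + l.+1).-1 (schouten (cocycle_field P) A).
  by rewrite addnS; apply: schouten_lowered.
(* Here d[P, A] = - (-1)^k [P, dA], so the sign is opposite to that for the wedge product. *)
exists (if odd k then schouten (cocycle_field P) A
        else - schouten (cocycle_field P) A).
  by case: odd => //; exact: lowered_opp.
case: (odd k) dE => dE.
  by apply: (etrans _ (esym dE)); rewrite schoutenNl opprK.
by apply: (etrans _ (esym (raddfN d _))); rewrite /= dE opprK.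
Qed.

End AffineOperations.

(** * The cohomology groups, degree by degree *)

Section CohomologyGroups.
Variable R : realType.
Local Notation mv := (mvfield R 3).
Local Notation Cinf := (Cinf R 3).
Local Notation x := (@Defs.coord R 3 ix).
Local Notation Dx := (partial ix).
Local Notation Dy := (partial iy).
Local Notation pi := (aff_poisson R).
Local Notation d := (schouten pi).
Implicit Types (P Q A : mv) (f g : Cinf).

Definition mvof (F : bool -> bool -> bool -> Cinf) : mv :=
  [ffun I : {set 'I_3} => F (ix \in I) (iy \in I) (iz \in I)].

Lemma mvcoef_of F : mvcoef (mvof F) = F.
Proof. by do 3![apply/funext => ?]; rewrite /mvcoef ffunE !mem_triset. Qed.

Lemma loweredE k P :
  (forall a b c : bool, (a + b + c)%N.+1 != k -> mvcoef P a b c = 0) ->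
  lowered k P.
Proof.
move=> H I; rewrite (trisetE I) card_triset => nk.
by rewrite -[LHS]/(mvcoef P _ _ _) H.
Qed.

Lemma homogeneous_mvcoef k P (a b c : bool) :
  homogeneous k P -> (a + b + c != k)%N -> mvcoef P a b c = 0.
Proof. by move=> hP nk; apply: hP; rewrite card_triset. Qed.

(** The coefficients are constant, and the only ones entering [cdiff] undifferentiated, along d_x
    and d_x ^ d_z, are zero. *)
Lemma basis_cocycle k (b c : bool) : (b + c)%N = k ->
  mvbasis R (triset false b c) \in cocycle_pred pi k.
Proof.
move=> <-; apply/asboolP; split=> [I|].
  rewrite (trisetE I) card_triset ffunE triset_inj.
  by case: and3P => // -[/eqP-> /eqP-> /eqP->]; rewrite eqxx.
apply: mvcoef_inj; rewrite mvcoef_differential.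
have -> : mvcoef (mvbasis R (triset false b c)) =
    fun a' b' c' => [&& a' == false, b' == b & c' == c]%:R.
  by do 3![apply/funext => ?]; rewrite mvcoef_basis.
have D0 i (e : bool) : partial i (e%:R : Cinf) = 0.
  by case: e; rewrite ?partial1 ?raddf0.
by do 3![apply/funext => -[]]; rewrite mvcoef0 /cdiff /=; do ?rewrite D0;
  rewrite /=; ring.
Qed.

Definition basis_class k (b c : bool) (bc : (b + c)%N = k) : cocycle pi k :=
  MkCocycle (basis_cocycle bc).

Lemma mvcoef_cocycleB k m (P : cocycle pi k) (c : 'I_m -> casimir pi)
    (e : 'I_m -> cocycle pi k) :
  mvcoef (cocycle_field (P - \sum_i c i *: e i)) =
  mvcoef (cocycle_field P - \sum_i (c i : Cinf) *: (cocycle_field (e i) : mv)).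
Proof. by rewrite -cocycle_field_sum. Qed.

(** A Casimir function does not depend on x, so it equals its restriction to [x = 0], where
    multiples of [x] vanish. This is what gives linear independence in degrees 1 and 2. *)
Lemma casimir_restr f u :
  f \in casimir_pred pi -> f = - (x * u) -> f = 0.
Proof.
move=> /casimirE[fx _] fu.
by rewrite (partial_eq0 fx) fu raddfN /= restr_coord oppr0.
Qed.

Lemma cohomology0_basis :
  is_basis [tuple cohom_class (@basis_class 0 false false erefl)].
Proof.
apply: (@cohomology_basis _ _ pi 0 1 _
  (fun=> @basis_class 0 false false erefl)).
- by move=> i; rewrite (ord1 i).
- move=> P.
  have hP := cocycle_homogeneous P.
  have cf : mvcoef (cocycle_field P) false false false \in casimir_pred pi.
    have := cocycle_closed P.
    move: (cocycle_field P) hP => F hF dF.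
    have dE a b c := mvcoef_eq0 a b c dF; rewrite mvcoef_differential in dE.
    apply/casimirE; split; apply: (@coord_mul_eq0 R 3 ix).
      by have /eqP := dE false true false; rewrite /= oppr_eq0 => /eqP.
    exact: (dE true false false).
  exists (fun=> MkCasimir cf); apply/coboundaryP; exists 0.
    exact: lowered_zero.
  rewrite raddf0; apply: mvcoef_inj; rewrite mvcoef_cocycleB big_ord1 /=.
  apply/funext => a; apply/funext => b; apply/funext => c.
  rewrite mvcoefB mvcoefZ mvcoef_basis mvcoef0.
  by case: a; case: b; case: c;
    rewrite /= ?mulr1 ?subrr// mulr0 subr0 (homogeneous_mvcoef hP).
- move=> c /coboundaryP[A lA]; rewrite cocycle_field_sum big_ord1 /=.
  rewrite (lowered0 lA) raddf0 => /(mvcoef_eq0 false false false).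
  rewrite mvcoefZ mvcoef_basis /= mulr1 => c0 i; rewrite (ord1 i).
  exact/val_inj.
Qed.

Lemma cocycle_cdiff k (P : cocycle pi k) a b c :
  cdiff Dx Dy x (mvcoef (cocycle_field P)) a b c = 0.
Proof.
by rewrite -mvcoef_differential; exact: mvcoef_eq0 (cocycle_closed P).
Qed.

Lemma casimir_coordM f : x * Dx f = 0 -> x * Dy f = 0 -> f \in casimir_pred pi.
Proof.
by move=> fx fy; apply/casimirE; split; apply: (@coord_mul_eq0 R 3 ix).
Qed.

(** [potential] treats the d_x and d_y components, and the other two cocycle equations make the d_z
    coefficient Casimir. A coboundary has d_y component divisible by [x] and no d_z component,
    whence freeness. *)
Lemma cohomology1_basis :
  is_basis [tuple cohom_class (@basis_class 1 true false erefl);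
                  cohom_class (@basis_class 1 false true erefl)].
Proof.
pose e (i : 'I_2) : cocycle pi 1 :=
  if i == 0 then @basis_class 1 true false erefl
  else @basis_class 1 false true erefl.
apply: (@cohomology_basis _ _ pi 1 2 _ e).
- by case=> -[|[|//]].
- move=> P; have hP := cocycle_homogeneous P.
  have dP := cocycle_cdiff P.
  have [f [r [aE bE rx ry]]] := potential (isT : ix != iy) (dP true true false).
  have cc : mvcoef (cocycle_field P) false false true \in casimir_pred pi.
    apply: casimir_coordM; last exact: (dP true false true).
    by have /eqP := dP false true true; rewrite /= oppr_eq0 => /eqP.
  have cr : r \in casimir_pred pi by apply/casimirE.
  exists (fun i => if i == 0 then MkCasimir cr else MkCasimir cc).
  apply/coboundaryP.
  exists (mvof (fun a b c => if [|| a, b | c] then 0 else f)).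
    by apply: loweredE => a b c; rewrite mvcoef_of; case: a; case: b; case: c.
  apply: mvcoef_inj; rewrite mvcoef_cocycleB mvcoef_differential mvcoef_of.
  apply/funext => a; apply/funext => b; apply/funext => c.
  rewrite mvcoefB !big_ord_recl big_ord0 addr0 mvcoefD.
  rewrite !mvcoefZ !mvcoef_basis /=.
  have [abc|abc] := eqVneq (a + b + c)%N 1%N;
    [|rewrite (homogeneous_mvcoef hP abc)];
    move: abc; case: a; case: b; case: c => // _;
    rewrite /= ?aE ?bE ?raddf0; ring.
- move=> c /coboundaryP[A lA].
  rewrite cocycle_field_sum !big_ord_recl big_ord0 addr0 /= => E.
  have {}E a b k :
      (c ord0 : Cinf) * [&& a == false, b == true & k == false]%:R +
      (c (lift ord0 ord0) : Cinf) * [&& a == false, b == false & k == true]%:R =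
      cdiff Dx Dy x (mvcoef A) a b k.
    by rewrite -mvcoef_differential -E mvcoefD !mvcoefZ !mvcoef_basis.
  have c0 : c ord0 = 0.
    have := E false true false; rewrite /= mulr1 mulr0 addr0 => Ec.
    by apply/val_inj; exact: (casimir_restr (casimirP (c ord0)) Ec).
  have c1 : c (lift ord0 ord0) = 0.
    apply/val_inj.
    by have := E false false true; rewrite /= mulr1 mulr0 add0r.
  case=> -[|[|//]] H.
    by rewrite -c0; congr c; exact/val_inj.
  by rewrite -c1; congr c; exact/val_inj.
Qed.

Lemma cohomology2_basis :
  is_basis [tuple cohom_class (@basis_class 2 true true erefl)].
Proof.
apply: (@cohomology_basis _ _ pi 2 1 _ (fun=> @basis_class 2 true true erefl)).
- by move=> i; rewrite (ord1 i).
- move=> P; have hP := cocycle_homogeneous P.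
  have dP := cocycle_cdiff P.
  have [f [r [aE bE rx ry]]] := potential (isT : ix != iy) (dP true true true).
  have cr : r \in casimir_pred pi by apply/casimirE.
  exists (fun=> MkCasimir cr).
  pose u := mvcoef (cocycle_field P) true true false.
  (* The term [f] d_z accounts for the components containing d_z. The other two terms yield [u]
     along d_x ^ d_y, as [- x * Dx u + x * Dx u + u = u]. *)
  apply/coboundaryP; exists (mvof (fun a b c =>
     if [&& a, ~~ b & ~~ c] then - u else
     if [&& ~~ a, b & ~~ c] then antider iy (Dx u) else
     if [&& ~~ a, ~~ b & c] then f else 0)).
    by apply: loweredE => a b c; rewrite mvcoef_of; case: a; case: b; case: c.
  apply: mvcoef_inj; rewrite mvcoef_cocycleB mvcoef_differential mvcoef_of.
  apply/funext => a; apply/funext => b; apply/funext => c.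
  rewrite mvcoefB big_ord1 !mvcoefZ !mvcoef_basis /=.
  have [abc|abc] := eqVneq (a + b + c)%N 2%N;
    [|rewrite (homogeneous_mvcoef hP abc)];
    move: abc; case: a; case: b; case: c => // _;
    rewrite /= ?aE ?bE ?raddf0 ?raddfN /= ?partial_antider -?/u; ring.
- move=> c /coboundaryP[A lA].
  rewrite cocycle_field_sum big_ord1 /= => E i; rewrite (ord1 i).
  have := mvcoef_differential A.
  rewrite -E => /(congr1 (fun F => F false true true)).
  rewrite mvcoefZ mvcoef_basis /= mulr1 => Ec.
  by apply/val_inj; exact: (casimir_restr (casimirP (c ord0)) Ec).
Qed.

Lemma cohomology3_eq0 (v : cohomology pi 3) : v = 0.
Proof.
have [P ->] := proj_quotmod_surj v.
transitivity (cohom_class (0 : cocycle pi 3)); last first.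
  apply/(addrI (cohom_class (0 : cocycle pi 3))).
  have cD := @proj_quotmodD _ _ (@coboundary_pred R 3 pi 3).
  by rewrite addr0 -[LHS](cD 0 0) addr0.
apply/cohom_class_eq/coboundaryP; rewrite subr0.
have hP := cocycle_homogeneous P.
pose t := mvcoef (cocycle_field P) true true true.
(* The primitive used for d_x ^ d_y in degree 2, with the spectator factor d_z appended. *)
exists (mvof (fun a b c => if [&& a, ~~ b & c] then - t else
     if [&& ~~ a, b & c] then antider iy (Dx t) else 0)).
  by apply: loweredE => a b c; rewrite mvcoef_of; case: a; case: b; case: c.
apply: mvcoef_inj; rewrite mvcoef_differential mvcoef_of.
apply/funext => a; apply/funext => b; apply/funext => c.
have [abc|abc] := eqVneq (a + b + c)%N 3%N;
  [|rewrite (homogeneous_mvcoef hP abc)];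
  move: abc; case: a; case: b; case: c => // _;
  rewrite /= ?raddf0 ?raddfN /= ?partial_antider -?/t; ring.
Qed.

End CohomologyGroups.

Theorem mainTheorem2 (R : realType) :
  let pi := aff_poisson R in
  let one := mvbasis R finset.set0 in
  let dy := vfield R iy in
  let dz := vfield R iz in
  poisson pi /\
  (forall F : 'rV[R]_3 -> R,
     (exists f : casimir pi, F = f) <->
     (exists2 g : R -> R, smooth1 g & F = (fun p => g (p 0 iz)))) /\
  (exists2 e : cocycle pi 0, cocycle_field e = one &
     is_basis [tuple cohom_class e]) /\
  (exists ey ez : cocycle pi 1,
     [/\ cocycle_field ey = dy, cocycle_field ez = dz &
         is_basis [tuple cohom_class ey; cohom_class ez]]) /\
  (exists2 eyz : cocycle pi 2, cocycle_field eyz = wedge dy dz &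
     is_basis [tuple cohom_class eyz]) /\
  (forall c : cohomology pi 3, c = 0) /\
  descends pi (@wedge R 3) addn /\
  descends pi (@schouten R 3) (fun k l => (k + l).-1) /\
  (forall P Q : mvfield R 3,
     casimir_span pi [:: one; dy; dz; wedge dy dz] P ->
     casimir_span pi [:: one; dy; dz; wedge dy dz] Q ->
     casimir_span pi [:: one; dy; dz; wedge dy dz] (wedge P Q) /\
     casimir_span pi [:: one; dy; dz; wedge dy dz] (schouten P Q)).
Proof.
move=> pi one dy dz.
split; first exact: aff_poisson_poisson.
split; first exact: casimir_functions.
split.
  exists (@basis_class R 0 false false erefl); last exact: cohomology0_basis.
  by rewrite /one triset0.
split.
  exists (@basis_class R 1 true false erefl),
    (@basis_class R 1 false true erefl).
  split; last exact: cohomology1_basis.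
    by rewrite /dy /vfield triset1.
  by rewrite /dz /vfield triset1.
split.
  exists (@basis_class R 2 true true erefl); last exact: cohomology2_basis.
  by rewrite /dy /dz wedge_dy_dz.
split; first exact: cohomology3_eq0.
split; first exact: descends_wedge.
split; first exact: descends_schouten.
move=> P Q /casimir_spanE iP /casimir_spanE iQ; split; apply/casimir_spanE.
  by rewrite mvcoef_wedge_fun; exact: transverse_wedge.
by rewrite mvcoef_schouten_fun; apply: transverse_schouten => // f;
  exact: partial_casimir.
Qed.
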